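(* Fix $0\le u\le\pi/4$, $L\ge2\pi$ and $\epsilon>0$. Let $F$ be a Cilleruelo field and let $G$ be a field of Cilleruelo type such that the spectral measures of $F$ and $G$ are $\epsilon$-close. Denote by $\mathcal{Z}_f,\mathcal{Z}_g$ the number of nodal intersections (zeroes) of $F$ and $G$ respectively on the straight line segment $\{t(\cos u,\sin u):0\le t\le L\}$ of direction $u$ and length $L=O(\epsilon^{\alpha-1})$ with some $\alpha>0$. Then, as $\epsilon\to0$, $$\mathbb{P}(\mathcal{Z}_g=0)=O(\epsilon^{\alpha}\log\epsilon)\qquad\text{if }u\ne0,$$ $$\mathbb{P}(\mathcal{Z}_g=0)\ge1-\frac{\sqrt2}{2}+O(\epsilon^{\alpha}\log\epsilon)\qquad\text{if }u=0 .$$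
   Context: The Cilleruelo field is $F(x)=\frac{\sqrt2}{2}[\beta_1\cos x_1+\gamma_1\sin x_1+\beta_2\cos x_2+\gamma_2\sin x_2]$, $x=(x_1,x_2)\in\mathbb{R}^2$, with $\beta_1,\beta_2,\gamma_1,\gamma_2$ i.i.d. standard real Gaussians; its spectral measure is $\frac14(\delta_{1}+\delta_{-1}+\delta_{i}+\delta_{-i})$ on the unit circle of $\mathbb{R}^2\cong\mathbb{C}$. A Cilleruelo type field $G$ with spectral measure $\epsilon$-close to that of $F$ is a unit variance, centred stationary Gaussian field on $\mathbb{R}^2$ whose spectral measure is purely atomic with $N=4M$ atoms of equal mass at points $y_j=(\cos\varphi_j,\sin\varphi_j)$, $j=1,\dots,N$, of the unit circle, invariant under rotation by $\pi/2$ about the origin, with $-\epsilon<\varphi_j<\epsilon$ for $j=1,\dots,M$, the other atoms being the rotations of these $M$ atoms by $\pi/2,\pi,3\pi/2$. Explicitly, with $y_{M+1},\dots,y_{2M}$ the rotations by $\pi/2$ of $y_1,\dots,y_M$, $G(x)=\frac{\sqrt2}{2}\big[\sum_{j=1}^{2M}b_j\cos\langle x,y_j\rangle+\sum_{j=1}^{2M}c_j\sin\langle x,y_j\rangle\big]$ with $b_j,c_j$ i.i.d. centred Gaussians of variance $4/N$. $O(\epsilon^\alpha\log\epsilon)$ denotes a quantity bounded in absolute value by a constant times $\epsilon^\alpha|\log\epsilon|$.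
   Formalization: For 0 < u < π/4 the first bound is proved only for segments with L ≥ π/cos u + π/sin u; with just L ≥ 2π it fails, e.g. for G = F and L = 2π, where the no-zero probability is a fixed positive number. *)

(* Defs.v *)
From HB Require Import structures.
From mathcomp Require Import all_boot all_order all_algebra.
From mathcomp Require Import all_classical all_reals all_analysis.
Set Implicit Arguments.
Unset Strict Implicit.
Unset Printing Implicit Defensive.
Import Order.TTheory GRing.Theory Num.Theory.
Import numFieldNormedType.Exports.
Local Open Scope classical_set_scope.
Local Open Scope ring_scope.

(* Mutual independence of a finite family of real random variables: the
   product rule over every subfamily. *)
Definition mutually_independent (d : measure_display) (T : measurableType d)
    (R : realType) (P : probability T R) (I : finType)
    (X : I -> {RV P >-> R}) : Prop :=
  forall (J : {set I}) (B : I -> set R), (forall i, measurable (B i)) ->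
    P (\bigcap_(i in [set` J]) (X i @^-1` B i)) =
    (\prod_(i in J) P (X i @^-1` B i))%E.

(* [normal_prob 0 s] is parametrized by the standard deviation [s], so [v]
   below is the variance. *)
Definition iid_centred_gaussian (d : measure_display) (T : measurableType d)
    (R : realType) (P : probability T R) (I : finType) (v : R)
    (X : I -> {RV P >-> R}) : Prop :=
  mutually_independent X /\
  forall i (A : set R), measurable A ->
    distribution P (X i) A = normal_prob 0 (Num.sqrt v) A.

Definition dot2 (R : realType) (x y : R * R) : R := x.1 * y.1 + x.2 * y.2.

(* The rotation of the plane by pi/2 about the origin. *)
Definition rot90 (R : realType) (x : R * R) : R * R := (- x.2, x.1).

(* The first 2M of the N = 4M atoms of the spectral measure: the points
   y_1, ..., y_M at angles phi_1, ..., phi_M, followed by their rotations by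
   pi/2.  The other 2M atoms are the opposites of these. *)
Definition atom (R : realType) (M : nat) (phi : 'I_M -> R)
    (j : 'I_(M + M)) : R * R :=
  match fintype.split j with
  | inl i => (cos (phi i), sin (phi i))
  | inr i => rot90 (cos (phi i), sin (phi i))
  end.

(* The Cilleruelo field; the coefficients are
   X 0 = beta_1, X 1 = gamma_1, X 2 = beta_2, X 3 = gamma_2. *)
Definition cilleruelo_field (d : measure_display) (T : measurableType d)
    (R : realType) (P : probability T R) (F : R * R -> T -> R) : Prop :=
  exists X : 'I_4 -> {RV P >-> R},
    iid_centred_gaussian 1 X /\
    forall x w, F x w = Num.sqrt 2 / 2 *
      (X (inord 0) w * cos x.1 + X (inord 1) w * sin x.1
       + X (inord 2) w * cos x.2 + X (inord 3) w * sin x.2).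

(* [G] is a field of Cilleruelo type whose spectral measure, the uniform
   probability on the 4M distinct atoms generated by [phi], is [e]-close to
   that of the Cilleruelo field.  The spectral measure determines [G] through
   its real spectral representation, whose cosine coefficients are the
   [X (inl j)] and whose sine coefficients are the [X (inr j)]. *)
Definition cilleruelo_type_field (d : measure_display) (T : measurableType d)
    (R : realType) (P : probability T R) (e : R) (G : R * R -> T -> R) : Prop :=
  exists (M : nat) (phi : 'I_M -> R)
         (X : ('I_(M + M) + 'I_(M + M))%type -> {RV P >-> R}),
    [/\ (0 < M)%N,
        injective phi,
        (forall j, - e < phi j < e),
        iid_centred_gaussian (4 / (4 * M)%:R) X &
        forall x w, G x w = Num.sqrt 2 / 2 *
          (\sum_j X (inl j) w * cos (dot2 x (atom phi j))
           + \sum_j X (inr j) w * sin (dot2 x (atom phi j)))].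

Definition segment (R : realType) (u L : R) : set (R * R) :=
  [set (t * cos u, t * sin u) | t in [set t : R | 0 <= t <= L]].

(* The number of zeroes of a realization of [G] on the segment; it may be
   +oo. *)
Definition nodal_intersections (d : measure_display) (T : measurableType d)
    (R : realType) (G : R * R -> T -> R) (u L : R) (w : T) : \bar R :=
  counting (segment u L `&` [set x | G x w = 0]).

(* How long the segment of direction u, 0 < u <= pi/4, has to be for the
   Cilleruelo field to have a zero on it almost surely.  Put a = cos u and
   b = sin u.  Every combination f of cos(at), sin(at), cos(bt), sin(bt)
   satisfies
     f(0) + f(pi/a) + f(pi/b) + f(pi/a + pi/b) = 0,
   and f(0) + f(pi/a) = 0 if a = b, where pi/a = sqrt(2) pi < 2 pi.
   The bound L >= 2 pi is not sufficient for 0 < u < pi/4: for small s > 0,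
     (1 + s) cos(b(t - pi)) - cos(a(t - pi)) > 0 for 0 <= t <= 2 pi. *)
Definition long_enough (R : realType) (u L : R) : Prop :=
  u = pi / 4 \/ pi / cos u + pi / sin u <= L.

(* Main.v *)
Require Import Defs.
From HB Require Import structures.
From mathcomp Require Import all_boot all_order all_algebra.
From mathcomp Require Import all_classical all_reals all_analysis.
From mathcomp Require Import measurable_realfun.
From mathcomp Require Import ring lra.
Import Order.TTheory GRing.Theory Num.Theory.
Import numFieldNormedType.Exports.
Local Open Scope classical_set_scope.
Local Open Scope ring_scope.

(** Along the ray t |-> (t cos u, t sin u) a field of Cilleruelo type is a
    Gaussian sum of waves cos (t f_j) and sin (t f_j) whose frequencies f_j lie
    within e of cos u or of sin u.  The number of atoms is arbitrary, so every
    estimate has to see the waves only through the exact Gaussian law of their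
    weighted sums ([weighted_sum_law], [three_block_law]); these laws follow from
    the convolution of Gaussian densities ([gauss_conv]).

    Suppose u <> 0.  The four limiting waves cos, sin of t cos u and t sin u
    cancel exactly when summed over the times 0, pi / cos u, pi / sin u and
    pi / cos u + pi / sin u (over 0 and pi / cos u if u = pi / 4).  Hence the sum
    S of the values of the field at these times is Gaussian with standard
    deviation O(e), whereas its value at the origin is a standard Gaussian.  A
    realization without zero has constant sign, so that |S| dominates the value at
    the origin; a small ball bound for that value and a tail bound for S, both
    taken at a level of order e |ln e|, show that this is unlikely
    ([nodal_prob_oblique]).  The logarithm is the price of the tail bound, and
    2 pi <= L <= K e^(alpha - 1) turns e into O(e^alpha).

    Suppose u = 0.  Then sqrt 2 times the field is
      cos t P1(t) + sin t P2(t) + P3(t)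
    where P1, P2, P3 only involve the frequencies f_j - 1 or f_j, which are
    at most e in absolute value.  Controlling all their Taylor coefficients at
    once shows that on a segment of length L they stay within O(L e |ln e|) of
    their initial values, off an event of probability O(e^alpha)
    ([trig_sum_slow]).  So the field has no zero as soon as |P3(0)| exceeds
    sqrt (P1(0)^2 + P2(0)^2) by such a margin.  The three initial values are
    independent standard Gaussians and the radius has tail exp (- r^2 / 2), which
    gives this cone the probability 1 - E exp (- Z^2 / 2) = 1 - sqrt 2 / 2 up to
    the margin ([gauss_cone], [nodal_prob_axis]). *)

Set Implicit Arguments.
Unset Strict Implicit.

(** * Integration against a density and affine changes of variable *)

Section Density.
Import HBNNSimple.

Lemma integral_density (d : measure_display) (T : measurableType d)
    (R : realType) (mu nu : {measure set T -> \bar R}) (p : T -> R)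
    (mp : measurable_fun setT p) (p0 : forall x, 0 <= p x)
    (nuE : forall A, measurable A -> nu A = (\int[mu]_(x in A) (p x)%:E)%E)
    (f : T -> \bar R) :
  measurable_fun setT f -> (forall x, 0 <= f x)%E ->
  (\int[nu]_x f x = \int[mu]_x (f x * (p x)%:E))%E.
Proof.
move=> mf f0.
pose f_ := nnsfun_approx measurableT mf.
have cvf x : (f_ n x)%:E @[n --> \oo] --> f x by exact: cvg_nnsfun_approx.
have ndf x : nondecreasing_seq (fun n => (f_ n x)%:E).
  by move=> m n mn; rewrite lee_fin; exact/lefP/nd_nnsfun_approx.
have simple (h : {nnsfun T >-> R}) :
    (\int[nu]_x (h x)%:E = \int[mu]_x ((h x)%:E * (p x)%:E))%E.
  under eq_integral do rewrite fimfunE -fsumEFin//.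
  rewrite ge0_integral_fsum//; last 2 first.
  - by move=> r; exact/measurable_EFinP/measurable_funM.
  - by move=> r x _; rewrite nnfun_muleindic_ge0.
  under [RHS]eq_integral.
    move=> x _; rewrite fimfunE -fsumEFin// muleC ge0_mule_fsumr; last first.
      by move=> r; rewrite EFinM nnfun_muleindic_ge0.
    over.
  rewrite [RHS]ge0_integral_fsum//; last 2 first.
  - move=> r; apply/measurable_EFinP; apply: measurable_funM => //.
    exact: measurable_funM.
  - move=> r x _; apply: mule_ge0; first by rewrite lee_fin.
    by rewrite EFinM nnfun_muleindic_ge0.
  apply: eq_fsbigr => r _; rewrite integralZl_indic_nnsfun// integral_indic//.
  rewrite setIT nuE//.
  have [r0|r0] := leP 0 r.
    rewrite -ge0_integralZl//; last 2 first.
    - exact/measurable_EFinP/measurable_funTS.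
    - by move=> x _; rewrite lee_fin.
    rewrite [LHS]integral_mkcond; apply: eq_integral => x _.
    rewrite patchE indicE; case: ifPn => _; last by rewrite mulr0 mule0.
    by rewrite mulr1 muleC.
  rewrite preimage_nnfun0// integral_set0 mule0 integral0_eq// => x _.
  by rewrite indicE in_set0 mulr0 mule0.
transitivity (limn (fun n => (\int[nu]_x (f_ n x)%:E)%E)).
  rewrite -monotone_convergence//.
  - by apply: eq_integral => x _; apply/esym/cvg_lim.
  - by move=> n; exact/measurable_EFinP/measurable_funTS.
  - by move=> n x _; rewrite lee_fin.
rewrite [RHS](_ : _ =
    limn (fun n => (\int[mu]_x ((f_ n x)%:E * (p x)%:E))%E)); last first.
  rewrite -monotone_convergence//.
  - apply: eq_integral => x _; apply/esym/cvg_lim => //.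
    by apply: cvgeZr => //; exact: cvf.
  - move=> n; apply/measurable_EFinP/measurable_funM => //.
  - by move=> n x _; rewrite mule_ge0 ?lee_fin.
  - by move=> x _ m n mn; rewrite lee_wpmul2r ?lee_fin//; exact: ndf.
by congr (limn _); apply/funext => n; exact: simple.
Qed.

End Density.

(** Bundles the image measure with the measurability of the map, which cannot be
    recovered from the underlying set function. *)
Definition image_measure (d d' : measure_display) (T : measurableType d)
    (T' : measurableType d') (R : realType) (m : {measure set T -> \bar R})
    (f : T -> T') (mf : measurable_fun setT f) : {measure set T' -> \bar R} :=
  measure_function_pushforward__canonical__measure_function_Measure m mf.

Lemma measurable_affine (R : realType) (a b : R) :
  measurable_fun [set: measurableTypeR R]
    ((fun x => a * x + b) : measurableTypeR R -> measurableTypeR R).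
Proof. by apply: measurable_funD => //; exact: measurable_funM. Qed.

(** Lebesgue measure is determined by its values on half-open intervals, where the
    identity is immediate. *)
Lemma lebesgue_measure_affine (R : realType) (a b : R) (A : set R) :
  a != 0 -> measurable A ->
  (lebesgue_measure A =
   `|a|%:E * lebesgue_measure ((fun x => (a * x + b)%R) @^-1` A))%E.
Proof.
move=> a0 mA.
pose f : measurableTypeR R -> measurableTypeR R := fun x => a * x + b.
have mf : measurable_fun setT f := measurable_affine a b.
rewrite (@lebesgue_measure_unique _
  (mscale `|a|%:nng (image_measure lebesgue_measure mf)))// => X [[p q] _ <-].
transitivity (`|a|%:E * lebesgue_measure (f @^-1` `]p, q]))%E; last by [].
have [agt0|alt0] : 0 < a \/ a < 0.
- by move: a0; rewrite neq_lt => /orP[]; [right|left].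
- rewrite (_ : f @^-1` _ = `](p - b) / a, (q - b) / a]%classic); last first.
    apply/seteqP; split => x; rewrite /= !in_itv/= /f ltr_pdivrMr//;
      rewrite ler_pdivlMr// => /andP[xp xq]; apply/andP; split; lra.
  rewrite !lebesgue_measure_itv/= !lte_fin ltr_pM2r ?invr_gt0// ltrD2r.
  case: ifPn => _; last by rewrite mule0.
  rewrite -!EFinD -EFinM gtr0_norm//; congr EFin.
  by rewrite -mulrBl mulrC divfK//; ring.
- rewrite (_ : f @^-1` _ = `[(q - b) / a, (p - b) / a[%classic); last first.
    apply/seteqP; split => x; rewrite /= !in_itv/= /f ler_ndivrMr//;
      rewrite ltr_ndivlMr// => /andP[xp xq]; apply/andP; split; lra.
  rewrite !lebesgue_measure_itv/= !lte_fin ltr_nM2r ?invr_lt0// ltrD2r.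
  case: ifPn => _; last by rewrite mule0.
  rewrite -!EFinD -EFinM ltr0_norm//; congr EFin.
  by rewrite -mulrBl mulNr mulrC divfK//; ring.
Qed.

Lemma integral_affine (R : realType) (a b : R) (f : R -> \bar R) :
  a != 0 -> measurable_fun setT f -> (forall x, 0 <= f x)%E ->
  (\int[lebesgue_measure]_x f x =
   `|a|%:E * \int[lebesgue_measure]_x f (a * x + b)%R)%E.
Proof.
move=> a0 mf f0.
pose g : measurableTypeR R -> measurableTypeR R := fun x => a * x + b.
have mg : measurable_fun setT g := measurable_affine a b.
transitivity (\int[mscale (`|a|%:nng)%R
    (image_measure lebesgue_measure mg)]_x f x)%E.
  apply: eq_measure_integral => A mA _.
  exact: lebesgue_measure_affine.
by rewrite ge0_integral_mscale// ge0_integral_pushforward.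
Qed.

(** Parametrized by the variance, with the Dirac mass for variance zero: some of
    the weights in the sums below may vanish, and with this convention scaling and
    convolution need no side condition. *)
Definition gauss (R : realType) (v : R) : probability (measurableTypeR R) R :=
  if v == 0 then (\d_(0 : measurableTypeR R) : probability (measurableTypeR R) R)
  else (normal_prob 0 (Num.sqrt v) : probability (measurableTypeR R) R).

(** * Centred Gaussian laws on the line *)

Lemma gaussE (R : realType) (v : R) (A : set R) : 0 < v ->
  gauss v A = normal_prob 0 (Num.sqrt v) A.
Proof. by move=> v0; rewrite /gauss gt_eqF. Qed.

Lemma gauss0E (R : realType) (A : set R) : gauss 0 A = (0 \in A)%:R%:E.
Proof. by rewrite /gauss eqxx; exact: diracE. Qed.

Lemma integral_gauss (R : realType) (v : R) (f : R -> \bar R) : 0 < v ->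
  measurable_fun setT f -> (forall x, 0 <= f x)%E ->
  (\int[gauss v]_x f x =
   \int[lebesgue_measure]_x (f x * (normal_pdf 0 (Num.sqrt v) x)%:E))%E.
Proof.
move=> v0 mf f0; apply: integral_density => //.
- exact: measurable_normal_pdf.
- by move=> x; exact: normal_pdf_ge0.
- by move=> A _; exact: gaussE.
Qed.

(** Unlike an integral over A, this form can be transported by a change of
    variable and by Tonelli's theorem. *)
Lemma gauss_indicE (R : realType) (v : R) (A : set R) : 0 < v ->
  measurable A -> gauss v A =
  (\int[lebesgue_measure]_x (\1_A x * normal_pdf 0 (Num.sqrt v) x)%:E)%E.
Proof.
move=> v0 mA; rewrite -[A in LHS]setIT -integral_indic//.
rewrite integral_gauss//.
by apply/measurable_EFinP; exact: measurable_indic.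
Qed.

Lemma normal_pdf_scale (R : realType) (a v x : R) : 0 < v -> a != 0 ->
  `|a| * normal_pdf 0 (Num.sqrt (a ^+ 2 * v)) (a * x) =
  normal_pdf 0 (Num.sqrt v) x.
Proof.
move=> v0 a0.
have a20 : 0 < a ^+ 2 by rewrite exprn_even_gt0.
have av0 : 0 < a ^+ 2 * v by rewrite mulr_gt0.
rewrite !normal_pdfE ?gt_eqF ?sqrtr_gt0// /normal_peak /normal_fun.
rewrite !subr0 !sqr_sqrtr ?ltW//.
have -> : a ^+ 2 * v * pi *+ 2 = a ^+ 2 * (v * pi *+ 2) by ring.
rewrite sqrtrM ?ltW// sqrtr_sqr invfM !mulrA divff ?normr_eq0// mul1r.
congr (_ * expR _); field.
by rewrite a0 gt_eqF.
Qed.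

Lemma gauss_scale (R : realType) (a v : R) (A : set R) : 0 <= v ->
  measurable A ->
  gauss v ((fun x : R => a * x) @^-1` A : set R) = gauss (a ^+ 2 * v) A.
Proof.
rewrite le_eqVlt => /predU1P[<-|v0] mA.
  by rewrite mulr0 !gauss0E; congr ((nat_of_bool _)%:R%:E);
     apply/idP/idP; rewrite !inE/= mulr0.
have [->|a0] := eqVneq a 0.
  rewrite (_ : 0 ^+ 2 * v = 0) ?expr0n ?mul0r// [RHS]gauss0E.
  have [/set_mem A0|A0] := boolP (0 \in A).
    rewrite [X in gauss v X](_ : _ = setT) ?probability_setT//.
    by apply/seteqP; split => // x _ /=; rewrite mul0r.
  rewrite [X in gauss v X](_ : _ = set0) ?measure0//.
  by apply/seteqP; split => // x /=; rewrite mul0r => /mem_set; apply/negP.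
have a20 : 0 < a ^+ 2 by rewrite exprn_even_gt0.
have mB : measurable ((fun x : R => a * x) @^-1` A).
  by rewrite -[X in measurable X]setTI; exact: mulrl_measurable.
have av0 : 0 < a ^+ 2 * v by rewrite mulr_gt0.
apply: (eq_trans (gauss_indicE v0 mB)).
apply: (eq_trans _ (esym (gauss_indicE av0 mA))).
rewrite [RHS](integral_affine 0 a0); last 2 first.
- apply/measurable_EFinP/measurable_funM => //; exact: measurable_normal_pdf.
- by move=> x; rewrite lee_fin mulr_ge0 ?normal_pdf_ge0.
rewrite -ge0_integralZl; last 4 first.
- exact: measurableT.
- apply/measurable_EFinP/measurable_funM => //.
    by apply: measurableT_comp => //; apply: measurable_affine.
  apply: measurableT_comp => //; first exact: measurable_normal_pdf.
  exact: measurable_affine.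
- by move=> x _; rewrite lee_fin mulr_ge0 ?normal_pdf_ge0.
- by rewrite lee_fin.
apply: eq_integral => x _.
by rewrite addr0 -EFinM mulrCA normal_pdf_scale.
Qed.

Lemma integral_gauss0 (R : realType) (f : R -> \bar R) :
  measurable_fun setT f -> (\int[gauss 0]_x f x = f 0%R)%E.
Proof. by move=> mf; rewrite /gauss eqxx integral_dirac// diracT mul1e. Qed.

(** Completing the square: the joint density of two independent Gaussians is the
    density of their sum times the conditional density of the first one. *)
Lemma normal_pdf_mul (R : realType) (v w x z : R) : 0 < v -> 0 < w ->
  normal_pdf 0 (Num.sqrt v) x * normal_pdf 0 (Num.sqrt w) (z - x) =
  normal_pdf 0 (Num.sqrt (v + w)) z *
  normal_pdf (z * v / (v + w)) (Num.sqrt (v * w / (v + w))) x.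
Proof.
move=> v0 w0; have vw0 : 0 < v + w by rewrite addr_gt0.
have t0 : 0 < v * w / (v + w) by rewrite divr_gt0// mulr_gt0.
rewrite !normal_pdfE ?gt_eqF ?sqrtr_gt0// /normal_peak /normal_fun.
rewrite !subr0 !sqr_sqrtr ?ltW//.
rewrite mulrACA [RHS]mulrACA -!expRD -!invfM -!sqrtrM; last 2 first.
- by rewrite mulrn_wge0// mulr_ge0 ?pi_ge0// ltW.
- by rewrite mulrn_wge0// mulr_ge0 ?pi_ge0// ltW.
congr ((Num.sqrt _)^-1 * expR _); field; rewrite ?gt_eqF//.
Qed.

Lemma measurable_add_preimage (R : realType) (A : set R) : measurable A ->
  measurable [set p : R * R | A (p.1 + p.2)].
Proof.
move=> mA; rewrite -[X in measurable X]setTI.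
by apply: (measurable_funD measurable_fst measurable_snd).
Qed.

(** By [normal_pdf_mul] the inner integral becomes that of a Gaussian density,
    which is 1, once Tonelli's theorem has put the value of the sum outside. *)
Lemma gauss_conv (R : realType) (v w : R) (A : set R) :
  0 <= v -> 0 <= w -> measurable A ->
  (gauss v \x gauss w)%E [set p : R * R | A (p.1 + p.2)] = gauss (v + w) A.
Proof.
move=> v0 w0 mA.
transitivity (\int[gauss v]_x gauss w [set y | A (x + y)%R])%E.
  apply: eq_integral => x _; rewrite /=.
  by congr (gauss w _); apply/seteqP; split => y; rewrite xsectionE.
have mAx (x : R) : measurable [set y | A (x + y)].
  rewrite -[X in measurable X]setTI.
  by apply: (measurable_funD (measurable_cst x) (@measurable_id _ _ setT)).
have mg : measurable_fun setT (fun x : R => gauss w [set y | A (x + y)]).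
  rewrite (_ : (fun _ => _) =
      gauss w \o xsection [set p : R * R | A (p.1 + p.2)]); last first.
    apply/funext => x /=; congr (gauss w _).
    by apply/seteqP; split => y; rewrite xsectionE.
  exact: (measurable_fun_xsection (gauss w) (measurable_add_preimage mA)).
move: v0; rewrite le_eqVlt => /predU1P[<-|v0].
  rewrite integral_gauss0.
    rewrite add0r; congr (gauss w _).
    by apply/seteqP; split => y; rewrite /= add0r.
  exact: mg.
move: w0; rewrite le_eqVlt => /predU1P[<-|w0].
  rewrite addr0; transitivity (\int[gauss v]_x (\1_A x)%:E)%E; last first.
    rewrite integral_indic; [|exact: measurableT|exact: mA].
    by rewrite setIT.
  apply: eq_integral => x _; rewrite gauss0E indicE.
  by congr ((nat_of_bool _)%:R%:E); apply/idP/idP; rewrite !inE/= addr0.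
have vw0 : 0 < v + w by rewrite addr_gt0.
apply: (eq_trans _ (esym (gauss_indicE vw0 mA))).
pose h x z := \1_A z * (normal_pdf 0 (Num.sqrt v) x *
  normal_pdf 0 (Num.sqrt w) (z - x)).
have mh : measurable_fun setT (fun p : R * R => (h p.1 p.2)%:E).
  apply/measurable_EFinP; apply: measurable_funM; last apply: measurable_funM.
  - by apply: measurableT_comp; [exact: measurable_indic|exact: measurable_snd].
  - apply: measurableT_comp; last exact: measurable_fst.
    exact: measurable_normal_pdf.
  - apply: measurableT_comp; first exact: measurable_normal_pdf.
    exact: (measurable_funB measurable_snd measurable_fst).
have h0 p : (0 <= (h p.1 p.2)%:E)%E.
  by rewrite lee_fin !mulr_ge0 ?normal_pdf_ge0.
rewrite integral_gauss; last 3 first.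
- by [].
- exact: mg.
- by move=> x; exact: measure_ge0.
transitivity (\int[lebesgue_measure]_x \int[lebesgue_measure]_z (h x z)%:E)%E.
  apply: eq_integral => x _.
  rewrite [X in (X * _)%E](gauss_indicE w0 (mAx x)).
  rewrite (integral_affine (-x) (oner_neq0 R)); last 2 first.
    apply/measurable_EFinP/measurable_funM; last exact: measurable_normal_pdf.
    exact: measurable_indic.
    by move=> y; rewrite lee_fin mulr_ge0 ?normal_pdf_ge0.
  rewrite normr1 mul1e -ge0_integralZr; last 4 first.
  - exact: measurableT.
  - apply/measurable_EFinP; apply: measurable_funM.
      apply: measurableT_comp; first exact: measurable_indic.
      exact: measurable_affine.
    apply: measurableT_comp; first exact: measurable_normal_pdf.
    exact: measurable_affine.
  - by move=> y _; rewrite lee_fin mulr_ge0 ?normal_pdf_ge0.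
  - by rewrite lee_fin normal_pdf_ge0.
  apply: eq_integral => z _; rewrite -EFinM /h; congr EFin.
  rewrite mul1r mulrAC -mulrA; congr (_ * _).
  rewrite !indicE; congr ((nat_of_bool _)%:R).
  by apply/idP/idP; rewrite !inE/= addrC subrK.
apply: (eq_trans (fubini_tonelli (m1 := lebesgue_measure)
  (m2 := lebesgue_measure) (fun p : R * R => (h p.1 p.2)%:E) mh h0)).
apply: eq_integral => z _ /=.
pose m := z * v / (v + w); pose s := Num.sqrt (v * w / (v + w)).
transitivity (\int[lebesgue_measure]_x
   ((\1_A z * normal_pdf 0 (Num.sqrt (v + w)) z)%:E * (normal_pdf m s x)%:E))%E.
  apply: eq_integral => x _; rewrite -EFinM /h normal_pdf_mul// mulrA//.
rewrite ge0_integralZl; last 4 first.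
- exact: measurableT.
- by apply/measurable_EFinP; exact: measurable_normal_pdf.
- by move=> x _; rewrite lee_fin normal_pdf_ge0.
- by rewrite lee_fin mulr_ge0 ?normal_pdf_ge0.
by rewrite integral_normal_pdf mule1.
Qed.

Lemma measurable_pred_set (d : measure_display) (T : measurableType d)
  (b : T -> bool) : measurable_fun setT b -> measurable [set x | b x].
Proof.
move=> mb; rewrite -[X in measurable X]setTI.
exact: (mb measurableT [set true]).
Qed.

Lemma measurable_ltr_set (d : measure_display) (T : measurableType d)
    (R : realType) (f g : T -> R) :
  measurable_fun setT f -> measurable_fun setT g ->
  measurable [set x | f x < g x].
Proof. by move=> mf mg; apply/measurable_pred_set/measurable_fun_ltr. Qed.

Lemma measurable_ler_set (d : measure_display) (T : measurableType d)
    (R : realType) (f g : T -> R) :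
  measurable_fun setT f -> measurable_fun setT g ->
  measurable [set x | f x <= g x].
Proof. by move=> mf mg; apply/measurable_pred_set/measurable_fun_ler. Qed.

(** Chernoff's bound with a single exponent, the inverse of the standard
    deviation: multiplying the density by the exponential gives a translated
    Gaussian density, of total mass 1, up to a constant. *)
Lemma gauss_tail (R : realType) (v s y : R) : 0 <= v <= s ^+ 2 -> 0 <= s ->
  0 <= y -> (gauss v [set x : R | (s * y < `|x|)%R] <= (2 * expR (1 / 2 - y))%:E)%E.
Proof.
move=> /andP[v0 vs] s0 y0.
have mA : measurable [set x : R | s * y < `|x|].
  exact: (measurable_ltr_set (measurable_cst _) (@normr_measurable _ setT)).
move: v0 vs; rewrite le_eqVlt => /predU1P[<-|v0] vs.
  rewrite gauss0E memNset ?lee_fin ?mulr_ge0 ?expR_ge0//=.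
  by rewrite normr0; apply/negP; rewrite -leNgt mulr_ge0.
rewrite (gauss_indicE v0 mA); set t := Num.sqrt v.
have t0 : 0 < t by rewrite sqrtr_gt0.
have ts : t <= s by rewrite -(ger0_norm s0) -sqrtr_sqr ler_sqrt// sqr_ge0.
have mp m : measurable_fun setT (fun x : R => (normal_pdf m t x)%:E).
  by apply/measurable_EFinP; exact: measurable_normal_pdf.
have p0 m (x : R) : (0 <= (normal_pdf m t x)%:E)%E.
  by rewrite lee_fin normal_pdf_ge0.
apply: (@le_trans _ _ (\int[lebesgue_measure]_x ((expR (1 / 2 - y))%:E *
    ((normal_pdf t t x)%:E + (normal_pdf (- t) t x)%:E)))%E); last first.
  rewrite ge0_integralZl; last 4 first.
  - exact: measurableT.
  - by apply: emeasurable_funD; exact: mp.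
  - by move=> x _; rewrite adde_ge0.
  - by rewrite lee_fin expR_ge0.
  rewrite ge0_integralD; last 5 first.
  - exact: measurableT.
  - by move=> x _; exact: p0.
  - exact: mp.
  - by move=> x _; exact: p0.
  - exact: mp.
  rewrite !integral_normal_pdf -EFinD -EFinM lee_fin.
  by rewrite mulrC.
apply: ge0_le_integral.
- exact: measurableT.
- by move=> x _; rewrite lee_fin mulr_ge0 ?normal_pdf_ge0.
- apply/measurable_EFinP/measurable_funM; last exact: measurable_normal_pdf.
  exact: measurable_indic.
- apply: emeasurable_funM => //; apply: emeasurable_funD; exact: mp.
move=> x _; rewrite -EFinD -EFinM lee_fin indicE.
case: (boolP (x \in _)) => [/set_mem /= xA|_]; last first.
  by rewrite mul0r mulr_ge0 ?expR_ge0 ?addr_ge0 ?normal_pdf_ge0.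
(* the density tilted by exp(x / t) is again Gaussian *)
have tilt e : e ^+ 2 = 1 -> expR (1 / 2 - y) * normal_pdf (e * t) t x =
    expR (e * x / t - y) * normal_pdf 0 t x.
  move=> e2; rewrite !normal_pdfE ?gt_eqF// /normal_fun.
  rewrite mulrCA [RHS]mulrCA -!expRD; congr (_ * expR _).
  have -> : (x - e * t) ^+ 2 = x ^+ 2 - 2 * e * x * t + e ^+ 2 * t ^+ 2 by ring.
  by rewrite e2; field; rewrite gt_eqF.
have e1 : expR (1 / 2 - y) * normal_pdf t t x =
    expR (x / t - y) * normal_pdf 0 t x.
  by have := tilt 1 (expr1n _ _); rewrite !mul1r.
have e2 : expR (1 / 2 - y) * normal_pdf (- t) t x =
    expR (- x / t - y) * normal_pdf 0 t x.
  by have := tilt (-1) (sqrr_sign R 1); rewrite !mulN1r.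
rewrite mulrDr e1 e2 -mulrDl.
rewrite ler_wpM2r ?normal_pdf_ge0//.
have xt : y < `|x| / t.
  rewrite ltr_pdivlMr// mulrC; apply: le_lt_trans xA.
  by rewrite ler_wpM2r.
have [x0|x0] := leP 0 x.
  rewrite -[1]addr0 lerD ?expR_ge0// -expR0 ler_expR subr_ge0 ltW//.
  by rewrite -(ger0_norm x0).
rewrite -[1]add0r lerD ?expR_ge0// -expR0 ler_expR subr_ge0 ltW//.
by rewrite -(ltr0_norm x0).
Qed.

(** The density is at most 1 / sqrt (2 pi) <= 1 / 2. *)
Lemma gauss_small_ball (R : realType) (e : R) : 0 <= e ->
  (gauss 1 [set x : R | (`|x| <= e)%R] <= e%:E)%E.
Proof.
move=> e0.
have -> : [set x : R | `|x| <= e] = `[- e, e]%classic.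
  by apply/seteqP; split => x; rewrite /= in_itv/= ler_norml.
rewrite gaussE// /normal_prob sqrtr1.
have n1 : 1 != 0 :> R by rewrite oner_neq0.
apply: (@le_trans _ _ (\int[lebesgue_measure]_(x in `[(- e)%R, e])
    (normal_peak 1)%:E)%E).
  apply: ge0_le_integral => //.
  - by move=> x _; rewrite lee_fin normal_pdf_ge0.
  - by apply/measurable_EFinP/measurable_funTS; exact: measurable_normal_pdf.
  - by move=> x _; rewrite lee_fin normal_pdf_ub.
rewrite integral_cst; last exact: measurable_itv.
rewrite /= lebesgue_measure_itv/= lte_fin.
case: ifPn => _; last by rewrite mule0 lee_fin.
rewrite -EFinD -EFinM lee_fin opprK /normal_peak expr1n mul1r.
have p2 : 4 <= pi *+ 2 :> R by have := pi_ge2 R; lra.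
have p0 : 0 < pi *+ 2 :> R by lra.
rewrite ler_pdivrMl ?sqrtr_gt0//.
have : 2 <= Num.sqrt (pi *+ 2) :> R; last by nra.
rewrite -[leLHS](ger0_norm (ler0n _ _)) -sqrtr_sqr (ler_sqrt _ (ltW p0)); lra.
Qed.

(** * The radius of a planar Gaussian vector *)

Lemma measurable_gauss_kernel (R : realType) :
  measurable_fun setT (fun x : R => expR (- x ^+ 2 / 2)).
Proof.
have -> : (fun x : R => expR (- x ^+ 2 / 2)) = normal_fun 0 1.
  by apply/funext => x; rewrite /normal_fun subr0 expr1n.
exact: measurable_normal_fun.
Qed.

Lemma is_derive_gauss_kernel (R : realType) (x : R) :
  is_derive x 1 (fun x : R => - expR (- x ^+ 2 / 2)) (x * expR (- x ^+ 2 / 2)).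
Proof.
apply: is_derive_eq.
by rewrite /GRing.scale/=; field.
Qed.

Lemma integral_gauss_kernel (R : realType) (r : R) : 0 <= r ->
  (\int[lebesgue_measure]_(x in `[r, +oo[) (x * expR (- x ^+ 2 / 2))%:E =
   (expR (- r ^+ 2 / 2))%:E)%E.
Proof.
move=> r0.
have cF : continuous (fun x : R => - expR (- x ^+ 2 / 2)).
  move=> x; apply: differentiable_continuous; apply/derivable1_diffP.
  by have [] := is_derive_gauss_kernel x.
rewrite (@ge0_continuous_FTC2y _ _ (fun x : R => - expR (- x ^+ 2 / 2)) _ 0).
- by rewrite -EFinD opprK add0r.
- by move=> x rx; rewrite mulr_ge0 ?expR_ge0// (le_trans r0).
- apply: continuous_subspaceT => x; apply: cvgM; first exact: cvg_id.
  rewrite -[X in _ --> X]opprK.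
  by under eq_fun do rewrite -[expR _]opprK; exact: cvgN (cF x).
- rewrite -oppr0; apply: cvgN.
  under eq_fun do rewrite mulNr.
  apply: (cvg_comp (fun x : R => x ^+ 2 / 2) (fun x => expR (- x))).
    by apply/gt0_cvgMly; [rewrite invr_gt0|exact: cvgr_expr2].
  exact: cvgr_expR.
- by move=> x _; have [] := is_derive_gauss_kernel x.
- exact/cvg_at_right_filter/cF.
- move=> x _; rewrite derive1E; have [_] := is_derive_gauss_kernel x; exact.
Qed.

(** For r >= 0 the two half-lines x >= r and - x >= r contribute equally. *)
Lemma integral_gauss_kernel_abs (R : realType) (k r : R) : 0 <= k -> 0 <= r ->
  (\int[lebesgue_measure]_x
     (`|x| * \1_[set y : R | (r <= `|y|)%R] x * (k * expR (- x ^+ 2 / 2)))%:E =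
   (k * 2 * expR (- r ^+ 2 / 2))%:E)%E.
Proof.
move=> k0 r0.
pose g (x : R) := x * \1_[set y : R | (r <= y)%R] x * (k * expR (- x ^+ 2 / 2)).
have mg : measurable_fun setT (fun x => (g x)%:E).
  apply/measurable_EFinP; apply: measurable_funM.
    apply: measurable_funM => //; apply: measurable_indic.
    exact: (measurable_ler_set (measurable_cst r) (@measurable_id _ _ setT)).
  apply: measurable_funM => //; exact: measurable_gauss_kernel.
have g0 (x : R) : (0 <= (g x)%:E)%E.
  rewrite lee_fin /g indicE; case: (boolP (x \in _)) => [/set_mem /= rx|_].
    by rewrite mulr1 !mulr_ge0 ?expR_ge0// (le_trans r0).
  by rewrite mulr0 mul0r.
have ig : (\int[lebesgue_measure]_x (g x)%:E = (k * expR (- r ^+ 2 / 2))%:E)%E.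
  rewrite EFinM -integral_gauss_kernel// -ge0_integralZl//; last 2 first.
  - apply/measurable_EFinP/measurable_funTS; apply: measurable_funM => //.
    exact: measurable_gauss_kernel.
  - move=> x /=; rewrite in_itv/= andbT => rx.
    by rewrite lee_fin mulr_ge0 ?expR_ge0// (le_trans r0).
  rewrite [RHS]integral_mkcond; apply: eq_integral => x _.
  rewrite patchE /g indicE.
  have -> : (x \in `[r, +oo[%classic) = (x \in [set y | r <= y]).
    by apply/idP/idP; rewrite !inE/= in_itv/= andbT.
  case: ifPn => _; last by rewrite mulr0 mul0r.
  by rewrite -EFinM mulr1 mulrCA.
transitivity (\int[lebesgue_measure]_x ((g x)%:E + (g (- x))%:E))%E.
  apply: eq_integral => x _; rewrite -EFinD; congr EFin.
  rewrite /g sqrrN -mulrDl; congr (_ * _); rewrite !indicE.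
  have memE (P : R -> Prop) y : (y \in [set z | P z]) = `[< P y >].
    by apply/idP/asboolP; rewrite inE.
  rewrite !memE !asboolb.
  have [x0|x0] := leP 0 x.
    suff -> : - x * (r <= - x)%R%:R = 0 by rewrite addr0 ger0_norm.
    have [rx|_] := leP r (- x); last by rewrite mulr0.
    by rewrite (_ : - x = 0) ?mul0r//; lra.
  suff -> : x * (r <= x)%R%:R = 0 by rewrite add0r ltr0_norm.
  by rewrite leNgt (lt_le_trans x0)// mulr0.
have mgN : measurable_fun setT (fun x : R => (g (- x))%:E).
  by apply: (measurableT_comp mg); exact: oppr_measurable.
have -> : (\int[lebesgue_measure]_x ((g x)%:E + (g (- x))%:E) =
   \int[lebesgue_measure]_x (g x)%:E + \int[lebesgue_measure]_x (g (- x))%:E)%E.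
  apply: ge0_integralD => //.
have N1 : -1 != 0 :> R by rewrite oppr_eq0 oner_neq0.
have gN := integral_affine 0 N1 mg g0.
rewrite normrN1 mul1e ig in gN.
have igN : (\int[lebesgue_measure]_x (g (- x)%R)%:E =
    (k * expR (- r ^+ 2 / 2))%:E)%E.
  by rewrite gN; apply: eq_integral => x _; rewrite addr0 mulN1r.
by rewrite ig igN -EFinD; congr EFin; ring.
Qed.

Lemma normal_pdf1E (R : realType) (x : R) :
  normal_pdf 0 1 x = normal_peak 1 * expR (- x ^+ 2 / 2).
Proof.
by rewrite normal_pdfE ?oner_neq0// /normal_fun subr0 expr1n.
Qed.

Lemma measurable_radius_ge (R : realType) (r : R) :
  measurable [set p : R * R | r ^+ 2 <= p.1 ^+ 2 + p.2 ^+ 2].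
Proof.
apply: (measurable_ler_set (measurable_cst _)).
by apply: measurable_funD; apply: measurable_funX;
  [exact: measurable_fst|exact: measurable_snd].
Qed.

(** Polar coordinates with the slope s = y / x in the place of the angle: for
    fixed x the substitution y = x s is linear, and after exchanging the integrals
    the substitution of x / sqrt (1 + s^2) for x is linear too.  The dependence on
    r then factors out. *)
Lemma gauss_radius_polar (R : realType) (r : R) : 0 <= r ->
  ((gauss 1 \x gauss 1) [set p : R * R | (r ^+ 2 <= p.1 ^+ 2 + p.2 ^+ 2)%R] =
   \int[lebesgue_measure]_(s in [set: R])
     ((1 + s ^+ 2)^-1 * (normal_peak 1 ^+ 2 * 2) *
      expR (- r ^+ 2 / 2))%:E)%E.
Proof.
move=> r0; pose k : R := normal_peak 1 ^+ 2.
have k0 : 0 <= k by rewrite exprn_ge0// normal_peak_ge0.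
pose A := [set p : R * R | r ^+ 2 <= p.1 ^+ 2 + p.2 ^+ 2].
have mA : measurable A := measurable_radius_ge r.
pose h (x s : R) := `|x| * \1_A (x, x * s) *
  (k * expR (- (x ^+ 2 + (x * s) ^+ 2) / 2)).
have mh : measurable_fun setT (fun p : R * R => (h p.1 p.2)%:E).
  have m1 : measurable_fun setT (fun p : R * R => p.1 * p.2).
    by apply: measurable_funM; [exact: measurable_fst|exact: measurable_snd].
  have m2 : measurable_fun setT (fun p : R * R => p.1 ^+ 2 + (p.1 * p.2) ^+ 2).
    exact: (measurable_funD (measurable_funX 2 measurable_fst)
                            (measurable_funX 2 m1)).
  apply/measurable_EFinP; apply: measurable_funM; apply: measurable_funM => //.
  - by apply: measurableT_comp => //; exact: measurable_fst.
  - apply: measurableT_comp; first exact: measurable_indic.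
    by apply: measurable_fun_pair => //; exact: measurable_fst.
  - apply: measurableT_comp => //; apply: measurable_funM => //.
    by apply: measurableT_comp.
have h0 p : (0 <= (h p.1 p.2)%:E)%E.
  rewrite lee_fin /h; apply: mulr_ge0; apply: mulr_ge0 => //; exact: expR_ge0.
have mAx (x : R) : measurable [set y | A (x, y)].
  apply: (measurable_ler_set (measurable_cst _)).
  exact: (measurable_funD (measurable_cst (x ^+ 2))
    (measurable_funX 2 (@measurable_id _ _ setT))).
transitivity (\int[lebesgue_measure]_x \int[lebesgue_measure]_s (h x s)%:E)%E.
  transitivity (\int[gauss 1]_x gauss 1 [set y | A (x, y)])%E.
    apply: eq_integral => x _; rewrite /=.
    by congr (gauss 1 _); apply/seteqP; split => y; rewrite xsectionE.
  have mg : measurable_fun setT (fun x : R => gauss 1 [set y | A (x, y)]).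
    rewrite (_ : (fun _ => _) = gauss 1 \o xsection A); last first.
      apply/funext => x /=; congr (gauss 1 _).
      by apply/seteqP; split => y; rewrite xsectionE.
    exact: (measurable_fun_xsection (gauss 1) mA).
  rewrite integral_gauss; last 3 first.
  - exact: ltr01.
  - exact: mg.
  - by move=> x; exact: measure_ge0.
  (* The substitution y = x s fails at x = 0 only. *)
  rewrite -[LHS](integral_setD1 (r := 0)); last 2 first.
  - exact: measurableD.
  - apply: measurable_funTS; apply: emeasurable_funM => //.
    by apply/measurable_EFinP; exact: measurable_normal_pdf.
  rewrite -[RHS](integral_setD1 (r := 0)); last 2 first.
  - exact: measurableD.
  - apply: measurable_funTS.
    exact: (measurable_fun_fubini_tonelli_F (m2 := lebesgue_measure)
      (fun p : R * R => (h p.1 p.2)%:E) mh h0).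
  apply: eq_integral => x /[!inE] -[_ /eqP x0].
  rewrite [X in (X * _)%E](gauss_indicE ltr01 (mAx x)) sqrtr1.
  rewrite (integral_affine 0 x0); last 2 first.
    apply/measurable_EFinP/measurable_funM; last exact: measurable_normal_pdf.
    exact: measurable_indic.
    by move=> y; rewrite lee_fin mulr_ge0 ?normal_pdf_ge0.
  rewrite muleAC -EFinM -ge0_integralZl; last 4 first.
  - exact: measurableT.
  - apply/measurable_EFinP; apply: measurable_funM.
      apply: measurableT_comp; first exact: measurable_indic.
      exact: measurable_affine.
    apply: measurableT_comp; first exact: measurable_normal_pdf.
    exact: measurable_affine.
  - by move=> y _; rewrite lee_fin mulr_ge0 ?normal_pdf_ge0.
  - by rewrite lee_fin mulr_ge0 ?normal_pdf_ge0.
  apply: eq_integral => s _; rewrite -EFinM addr0 /h; congr EFin.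
  rewrite !normal_pdf1E.
  have -> : - (x ^+ 2 + (x * s) ^+ 2) / 2 =
      - x ^+ 2 / 2 + - (x * s) ^+ 2 / 2 by ring.
  have -> : \1_[set y | A (x, y)] (x * s) = \1_A (x, x * s) :> R.
    by rewrite !indicE; congr ((nat_of_bool _)%:R); apply/idP/idP; rewrite !inE.
  by rewrite expRD /k; ring.
apply: (eq_trans (fubini_tonelli (m1 := lebesgue_measure)
  (m2 := lebesgue_measure) (fun p : R * R => (h p.1 p.2)%:E) mh h0)).
apply: eq_integral => s _ /=.
have s0 : 0 < 1 + s ^+ 2 by rewrite ltr_pwDl// sqr_ge0.
pose a := (Num.sqrt (1 + s ^+ 2))^-1.
have agt0 : 0 < a by rewrite invr_gt0 sqrtr_gt0.
have a0 : a != 0 by rewrite gt_eqF.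
have mhs : measurable_fun setT (fun x => (h x s)%:E).
  exact: (measurableT_comp mh
    (measurable_fun_pair (@measurable_id _ _ setT) (measurable_cst s))).
have a2 : a ^+ 2 = (1 + s ^+ 2)^-1 by rewrite exprVn sqr_sqrtr// ltW.
rewrite (integral_affine 0 a0); last 2 first.
  exact: mhs.
  by move=> y; exact: (h0 (y, s)).
rewrite -ge0_integralZl; last 4 first.
- exact: measurableT.
- by apply: (measurableT_comp mhs); exact: measurable_affine.
- by move=> y _; exact: (h0 (a * y + 0, s)).
- by rewrite lee_fin.
transitivity ((a ^+ 2)%:E * (k * 2 * expR (- r ^+ 2 / 2))%:E)%E; last first.
  by rewrite -EFinM a2 -/k; congr EFin; ring.
have mB : measurable [set y : R | r <= `|y|].
  exact: (measurable_ler_set (measurable_cst _) (@normr_measurable _ setT)).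
rewrite -integral_gauss_kernel_abs// -ge0_integralZl; last 4 first.
- exact: measurableT.
- apply/measurable_EFinP; apply: measurable_funM; apply: measurable_funM => //.
  exact: measurable_gauss_kernel.
- move=> x _; rewrite lee_fin; apply: mulr_ge0; apply: mulr_ge0 => //.
- by rewrite lee_fin sqr_ge0.
apply: eq_integral => x _; rewrite -!EFinM; congr EFin.
rewrite addr0 /h normrM (gtr0_norm agt0).
have e : (a * x) ^+ 2 + (a * x * s) ^+ 2 = x ^+ 2.
  by rewrite !exprMn a2; field; rewrite gt_eqF.
have -> : \1_A (a * x, a * x * s) = \1_[set y | r <= `|y|] x :> R.
  rewrite !indicE; congr ((nat_of_bool _)%:R).
  have rx : (r ^+ 2 <= x ^+ 2) = (r <= `|x|).
    by rewrite -(real_normK (num_real x)) ler_sqr// nnegrE.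
  by apply/idP/idP; rewrite !inE /A/= e rx.
by rewrite e; ring.
Qed.

(** In [gauss_radius_polar] the integral over the slopes is the same for all r;
    its value need not be computed, since the case r = 0 says that the total mass
    is 1. *)
Lemma gauss_radius_tail (R : realType) (r : R) : 0 <= r ->
  ((gauss 1 \x gauss 1) [set p : R * R | (r ^+ 2 <= p.1 ^+ 2 + p.2 ^+ 2)%R] =
   (expR (- r ^+ 2 / 2))%:E)%E.
Proof.
move=> r0; rewrite gauss_radius_polar//.
have := gauss_radius_polar (lexx (0 : R)).
rewrite [X in (_ \x _)%E X](_ : _ = setT); last first.
  by apply/seteqP; split => // p _ /=; rewrite expr0n/= addr_ge0 ?sqr_ge0.
rewrite probability_setT expr0n/= oppr0 mul0r expR0 => one.
under eq_integral do rewrite EFinM muleC.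
rewrite ge0_integralZl; last 4 first.
- exact: measurableT.
- apply/measurable_EFinP; apply: measurable_funM => //.
  by apply: continuous_measurable_fun; exact: continuous_oneDsqrV.
- move=> s _; rewrite lee_fin mulr_ge0 ?mulr_ge0 ?exprn_ge0 ?normal_peak_ge0//.
  by rewrite invr_ge0 addr_ge0 ?sqr_ge0.
- by rewrite lee_fin expR_ge0.
rewrite -[RHS]mule1 one; congr (_ * _)%E.
by apply: eq_integral => s _; rewrite mulr1.
Qed.

(** The integrand is sqrt 2 / 2 times the density of variance 1 / 2. *)
Lemma integral_gauss_kernel_gauss (R : realType) :
  (\int[gauss 1]_(z in [set: R]) (expR (- z ^+ 2 / 2))%:E =
   (Num.sqrt 2 / 2)%:E)%E.
Proof.
rewrite integral_gauss; last 3 first.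
- exact: ltr01.
- by apply/measurable_EFinP; exact: measurable_gauss_kernel.
- by move=> z; rewrite lee_fin expR_ge0.
have s0 : 0 < 1 / 2 :> R by [].
transitivity (\int[lebesgue_measure]_(z in [set: R]) ((Num.sqrt 2 / 2)%:E *
    (normal_pdf 0 (Num.sqrt (1 / 2)) z)%:E)%E)%E.
  apply: eq_integral => z _; rewrite -!EFinM; congr EFin.
  rewrite !normal_pdfE ?gt_eqF ?sqrtr_gt0// /normal_peak /normal_fun.
  rewrite !subr0 !sqr_sqrtr ?ler01 ?(ltW s0)//.
  rewrite mulrCA -expRD [RHS]mulrA; congr (_ * expR _); last by field.
  have s2 : 0 < Num.sqrt 2 :> R by rewrite sqrtr_gt0.
  have -> : 1 / 2 * pi *+ 2 = pi :> R by field.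
  rewrite mul1r -mulr_natl sqrtrM// invfM; congr (_ * _).
  rewrite -[X in _ = _ / X](sqr_sqrtr (ler0n _ _)); field.
  by rewrite gt_eqF.
rewrite ge0_integralZl; last 4 first.
- exact: measurableT.
- by apply/measurable_EFinP; exact: measurable_normal_pdf.
- by move=> x _; rewrite lee_fin normal_pdf_ge0.
- by rewrite lee_fin divr_ge0.
by rewrite integral_normal_pdf mule1.
Qed.

(** The derivative of exp (- z^2 / 2) is bounded by 1; the factor 2 leaves room for
    an argument by 1 + x <= exp x alone. *)
Lemma gauss_kernel_shift (R : realType) (e z : R) : 0 <= e <= z ->
  expR (- (z - e) ^+ 2 / 2) <= expR (- z ^+ 2 / 2) + 2 * e.
Proof.
move=> /andP[e0 ez].
have [e2|e2] := leP 1 e.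
  apply: (@le_trans _ _ 1).
    by rewrite -expR0 ler_expR mulNr oppr_le0 divr_ge0 ?sqr_ge0.
  by rewrite -[1]add0r lerD ?expR_ge0//; lra.
have [y y0 ->] : exists2 y, 0 <= y & z = y + e.
  by exists (z - e); rewrite ?subrK// subr_ge0.
rewrite addrK.
have -> : - (y + e) ^+ 2 / 2 = - y ^+ 2 / 2 - (y * e + e ^+ 2 / 2) by field.
rewrite expRD; set h := expR _; set c := y * e + _.
have c1 : 1 - c <= expR (- c) by exact: expR_ge1Dx.
have h0 : 0 < h by exact: expR_gt0.
have h1 : h <= 1 by rewrite -expR0 ler_expR mulNr oppr_le0 divr_ge0 ?sqr_ge0.
have hy : h * y <= 1.
  rewrite /h mulNr expRN mulrC ler_pdivrMr ?expR_gt0// mul1r.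
  have := expR_ge1Dx (y ^+ 2 / 2); have := sqr_ge0 (y - 1); nra.
have hc : h * c <= 2 * e by rewrite /c; nra.
nra.
Qed.

(** Packs the product as a probability, so that products can be nested. *)
Definition joint_law (d1 d2 : measure_display) (T1 : measurableType d1)
    (T2 : measurableType d2) (R : realType) (mu : probability T1 R)
    (nu : probability T2 R) : probability (T1 * T2)%type R := (mu \x nu)%E.

Lemma measurable_radius (R : realType) :
  measurable_fun setT (fun p : R * R => Num.sqrt (p.1 ^+ 2 + p.2 ^+ 2)).
Proof.
  have m2 : measurable_fun setT (fun p : R * R => p.1 ^+ 2 + p.2 ^+ 2).
    exact: (measurable_funD (measurable_funX 2 measurable_fst)
                            (measurable_funX 2 measurable_snd)).
  apply: (measurableT_comp _ m2); apply: continuous_measurable_fun.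
  exact: sqrt_continuous.
Qed.

Lemma measurable_cone (R : realType) (c : R) :
  measurable [set q : R * (R * R) |
    `|q.1| - c <= Num.sqrt (q.2.1 ^+ 2 + q.2.2 ^+ 2)].
Proof.
  have m1 : measurable_fun setT (fun q : R * (R * R) => `|q.1| - c).
    apply: measurable_funB; last exact: measurable_cst.
    exact: (measurableT_comp (@normr_measurable _ setT) measurable_fst).
  exact: (measurable_ler_set m1
    (measurableT_comp (@measurable_radius R) measurable_snd)).
Qed.

(** Given z, the radius exceeds |z| - e with probability
    exp (- (|z| - e)^2 / 2), or 1 if |z| < e.  Both are at most
    exp (- z^2 / 2) + 2 e, whose mean is computed above. *)
Lemma gauss_cone (R : realType) (e : R) : 0 <= e ->
  ((gauss 1 \x joint_law (gauss 1) (gauss 1))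
     [set q : R * (R * R) |
       (`|q.1| - e <= Num.sqrt (q.2.1 ^+ 2 + q.2.2 ^+ 2))%R] <=
   (Num.sqrt 2 / 2 + 2 * e)%:E)%E.
Proof.
move=> e0.
have mC := measurable_cone e.
apply: (@le_trans _ _ (\int[gauss 1]_(z in [set: R])
    ((expR (- z ^+ 2 / 2))%:E + (2 * e)%:E))%E); last first.
  rewrite ge0_integralD; last 5 first.
  - exact: measurableT.
  - by move=> z _; rewrite lee_fin expR_ge0.
  - by apply/measurable_EFinP; exact: measurable_gauss_kernel.
  - by move=> z _; rewrite lee_fin mulr_ge0.
  - exact: measurable_cst.
  rewrite integral_gauss_kernel_gauss integral_cst; last exact: measurableT.
  rewrite [X in (_ + _ * X)%E](_ : _ = 1%E); last exact: probability_setT.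
  by rewrite mule1 EFinD.
apply: ge0_le_integral.
- exact: measurableT.
- by move=> z _; exact: measure_ge0.
- exact: (measurable_fun_xsection (joint_law (gauss 1) (gauss 1)) mC).
- apply/measurable_EFinP; apply: measurable_funD => //.
  exact: measurable_gauss_kernel.
move=> z _ /=.
have sectE : xsection [set q : R * (R * R) |
    `|q.1| - e <= Num.sqrt (q.2.1 ^+ 2 + q.2.2 ^+ 2)] z =
    [set p | `|z| - e <= Num.sqrt (p.1 ^+ 2 + p.2 ^+ 2)].
  by apply/seteqP; split => p; rewrite xsectionE.
rewrite sectE -EFinD.
have [ze|ze] := leP e `|z|.
  rewrite (_ : mkset _ = [set p | (`|z| - e) ^+ 2 <= p.1 ^+ 2 + p.2 ^+ 2]).
    rewrite gauss_radius_tail ?subr_ge0// lee_fin.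
    rewrite -(real_normK (num_real z)).
    by rewrite gauss_kernel_shift// e0.
  apply/funext => p; congr is_true; rewrite -subr_ge0 in ze.
  rewrite -[X in X <= _ = _](ger0_norm ze) -sqrtr_sqr ler_sqrt//.
  by rewrite addr_ge0 ?sqr_ge0.
apply: (le_trans (probability_le1 _ _)).
  exact: (measurable_ler_set (measurable_cst _) (@measurable_radius R)).
rewrite lee_fin.
have z1 := expR_ge1Dx (- z ^+ 2 / 2); have h0 := expR_gt0 (- z ^+ 2 / 2).
have z2 : z ^+ 2 < e ^+ 2 by rewrite -(real_normK (num_real z)) ltr_sqr ?nnegrE.
have [e1|e1] := leP e 1; nra.
Qed.

(** * Independence and the laws of weighted sums *)

(** Independence on rectangles determines the joint law, by uniqueness of the
    product measure.  Conditioning on D allows the lemma to be applied while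
    further variables are still constrained. *)
Lemma joint_law_of_indep (d d1 d2 : measure_display) (T : measurableType d)
    (T1 : measurableType d1) (T2 : measurableType d2) (R : realType)
    (P : probability T R) (mu : probability T1 R) (nu : probability T2 R)
    (X : T -> T1) (Y : T -> T2) (D : set T) (E : set (T1 * T2)) :
  measurable_fun setT X -> measurable_fun setT Y -> measurable D ->
  (forall A B, measurable A -> measurable B ->
    P (D `&` (X @^-1` A `&` Y @^-1` B)) = P D * (mu A * nu B))%E ->
  measurable E ->
  (P (D `&` [set w | E (X w, Y w)]) = P D * joint_law mu nu E)%E.
Proof.
move=> mX mY mD PAB mE.
have mXY : measurable_fun setT (fun w => (X w, Y w)).
  exact: measurable_fun_pair.
have mXYE : measurable [set w | E (X w, Y w)].
  by rewrite -[X in measurable X]setTI; exact: mXY.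
have [PD0|PD0] := eqVneq (P D) 0%E.
  rewrite PD0 mul0e; apply: (subset_measure0 _ _ _ PD0) => //.
  exact: measurableI.
have PDfin : P D \is a fin_num by exact: fin_num_measure.
have c0 : 0 <= (fine (P D))^-1 by rewrite invr_ge0 fine_ge0.
pose m := mscale (NngNum c0) (image_measure (mrestr P mD) mXY).
have fPD0 : fine (P D) != 0 by rewrite fine_eq0.
have mF F : m F = ((fine (P D))^-1%:E * P (D `&` [set w | F (X w, Y w)]))%E.
  by rewrite setIC.
have cPD : ((fine (P D))^-1%:E * P D = 1)%E.
  by rewrite -[X in (_ * X)%E]fineK// -EFinM mulVf.
have -> : joint_law mu nu E = m E.
  apply: product_measure_unique => // A B mA mB.
  by apply: (eq_trans (mF _)); rewrite PAB// muleA cPD mul1e.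
by rewrite mF muleA (muleC (P D)) cPD mul1e.
Qed.

Lemma bigcap_cons (T : Type) (I : eqType) (i : I) (s : seq I)
    (F : I -> set T) :
  \bigcap_(j in [set` i :: s]) F j = F i `&` \bigcap_(j in [set` s]) F j.
Proof.
apply/seteqP; split => [w Fw|w [Fiw Fw] j /=].
  by split => [|j js]; apply: Fw; rewrite /= inE ?eqxx// js orbT.
by rewrite inE => /predU1P[->//|js]; exact: Fw.
Qed.

Lemma measurable_bigcap_seq (d : measure_display) (T : measurableType d)
    (I : eqType) (s : seq I) (F : I -> set T) :
  (forall i, measurable (F i)) -> measurable (\bigcap_(i in [set` s]) F i).
Proof.
move=> mF; elim: s => [|i s IH]; last by rewrite bigcap_cons; exact: measurableI.
by rewrite (_ : [set` [::]] = set0) ?bigcap_set0//; apply/seteqP; split.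
Qed.

(** Given D, the variables Y i with i in s are independent centred Gaussians of
    variances v i.  The event D stands for whatever is already known about other
    variables, which makes the notion stable under the removal of a block of
    variables from s. *)
Definition indep_gauss (d : measure_display) (T : measurableType d)
    (R : realType) (P : probability T R) (I : eqType) (Y : I -> T -> R)
    (v : I -> R) (s : seq I) (D : set T) : Prop :=
  forall B : I -> set R, (forall i, measurable (B i)) ->
    (P (D `&` \bigcap_(i in [set` s]) (Y i @^-1` B i)) =
     P D * \prod_(i <- s) gauss (v i) (B i))%E.

(** Induction on the block s: the first variable joins D, the induction hypothesis
    applies to the rest of the block, and then [joint_law_of_indep] and
    [gauss_conv] handle the sum of the two. *)
Lemma indep_gauss_sum (d : measure_display) (T : measurableType d)
    (R : realType) (P : probability T R) (I : eqType) (Y : I -> T -> R)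
    (v : I -> R) (s t : seq I) (D : set T) (A : set R) (B : I -> set R) :
  (forall i, measurable_fun setT (Y i)) -> (forall i, 0 <= v i) ->
  measurable D -> uniq (s ++ t) -> indep_gauss P Y v (s ++ t) D ->
  measurable A -> (forall i, measurable (B i)) ->
  (P (D `&` [set w | A (\sum_(i <- s) Y i w)%R] `&`
      \bigcap_(i in [set` t]) (Y i @^-1` B i)) =
   P D * gauss (\sum_(i <- s) v i)%R A * \prod_(i <- t) gauss (v i) (B i))%E.
Proof.
move=> mY v0; elim: s D A B => [|i s IH] D A B mD.
  move=> _ iD mA mB.
  under eq_set do rewrite big_nil.
  have g0 : gauss (\sum_(i <- [::]) v i) A = (0 \in A)%:R%:E.
    rewrite big_nil.
    exact: gauss0E.
  transitivity (P D * (0 \in A)%:R%:E * \prod_(i <- t) gauss (v i) (B i))%E;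
    last by congr (_ * _ * _)%E; exact: esym g0.
  have [/set_mem A0|A0] := boolP (0 \in A).
    rewrite (_ : [set _ | A 0] = setT) ?setIT ?mule1; last first.
      by apply/seteqP; split.
    exact: iD.
  rewrite (_ : [set _ | A 0] = set0) ?setI0 ?set0I ?measure0 ?mule0 ?mul0e//.
  by apply/seteqP; split => // w /= /mem_set; rewrite (negbTE A0).
rewrite cat_cons cons_uniq => /andP[inst ust] iD mA mB.
have inst' : i \notin t by move: inst; rewrite mem_cat negb_or => /andP[].
have subst_i (C : set R) (B' : I -> set R) :
    (\prod_(j <- s ++ t) gauss (v j) ((if j == i then C else B' j) : set R) =
     \prod_(j <- s ++ t) gauss (v j) (B' j))%E.
  rewrite !big_seq; apply: eq_bigr => j jst.
  by case: eqP => // ji; move: inst; rewrite -ji jst.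
have capE (C : set R) (B' : I -> set R) :
    \bigcap_(j in [set` i :: s ++ t])
      (Y j @^-1` ((if j == i then C else B' j) : set R)) =
    Y i @^-1` C `&` \bigcap_(j in [set` s ++ t]) (Y j @^-1` B' j).
  rewrite bigcap_cons eqxx; congr (_ `&` _).
  apply: eq_bigcapr => j /= jst.
  by case: eqP => // ji; move: inst; rewrite -ji jst.
have mC C : measurable C -> measurable (Y i @^-1` C).
  by move=> ?; rewrite -[X in measurable X]setTI; exact: mY.
have mst (B' : I -> set R) : (forall j, measurable (B' j)) ->
    measurable (\bigcap_(j in [set` t]) (Y j @^-1` B' j)).
  move=> mB'; apply: measurable_bigcap_seq => j.
  by rewrite -[X in measurable X]setTI; exact: mY.
have key (C : set R) (B' : I -> set R) : measurable C ->
    (forall j, measurable (B' j)) ->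
    (P (D `&` Y i @^-1` C `&` \bigcap_(j in [set` s ++ t]) (Y j @^-1` B' j)) =
    P D * gauss (v i) C * \prod_(j <- s ++ t) gauss (v j) (B' j))%E.
  move=> mC' mB'.
  have := iD (fun j => if j == i then C else B' j).
  rewrite capE big_cons eqxx subst_i setIA muleA; apply.
  by move=> j; case: ifP.
have keyT (C : set R) : measurable C ->
    (P (D `&` Y i @^-1` C) = P D * gauss (v i) C)%E.
  move=> mC'; have := key C (fun=> setT) mC' (fun=> measurableT).
  rewrite (_ : \bigcap_(_ in _) _ = setT) ?setIT; last first.
    by apply/seteqP; split.
  by move=> ->; rewrite big1 ?mule1// => j _; exact: probability_setT.
pose D' := D `&` \bigcap_(j in [set` t]) (Y j @^-1` B j).
have mD' : measurable D' by apply: measurableI => //; exact: mst.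
have IHC C A' : measurable C -> measurable A' ->
    (P (D `&` Y i @^-1` C `&` [set w | A' (\sum_(j <- s) Y j w)%R] `&`
        \bigcap_(j in [set` t]) (Y j @^-1` B j)) =
     P D * gauss (v i) C * gauss (\sum_(j <- s) v j)%R A' *
       \prod_(j <- t) gauss (v j) (B j))%E.
  move=> mC' mA'; rewrite IH//.
  - by rewrite keyT.
  - by apply: measurableI => //; exact: mC.
  - by move=> B' mB'; rewrite key// keyT.
have PD' : (P D' = P D * \prod_(j <- t) gauss (v j) (B j))%E.
  have := IHC setT setT measurableT measurableT.
  rewrite preimage_setT (_ : [set _ | setT _] = setT); last first.
    by apply/seteqP; split.
  rewrite !setIT => ->; congr (_ * _)%E.
  rewrite -[RHS]mule1 -[RHS]mule1.
  by congr (_ * _ * _)%E; exact: probability_setT.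
have pair C A' : measurable C -> measurable A' ->
    (P (D' `&` (Y i @^-1` C `&` [set w | A' (\sum_(j <- s) Y j w)%R])) =
     P D' * (gauss (v i) C * gauss (\sum_(j <- s) v j)%R A'))%E.
  move=> mC' mA'; rewrite PD' muleAC muleA -IHC//; congr (P _).
  by rewrite /D' setIAC setIA.
have mS : measurable_fun setT (fun w => \sum_(j <- s) Y j w).
  by apply: measurable_sum.
have vE : gauss (\sum_(j <- i :: s) v j) A =
    joint_law (gauss (v i)) (gauss (\sum_(j <- s) v j))
      [set p : R * R | A (p.1 + p.2)].
  rewrite big_cons; apply: esym; apply: gauss_conv => //.
  by rewrite sumr_ge0.
have mE := measurable_add_preimage mA.
have E1 : (P (D' `&` [set w | A (Y i w + \sum_(j <- s) Y j w)%R]) =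
    P D' * joint_law (gauss (v i)) (gauss (\sum_(j <- s) v j)%R)
      [set p : R * R | A (p.1 + p.2)%R])%E.
  apply: (@joint_law_of_indep d _ _ T (measurableTypeR R) (measurableTypeR R) R
    P (gauss (v i)) (gauss (\sum_(j <- s) v j)) (Y i)
    (fun w => \sum_(j <- s) Y j w) D' [set p : R * R | A (p.1 + p.2)%R]).
  - exact: mY.
  - exact: mS.
  - exact: mD'.
  - exact: pair.
  - exact: mE.
transitivity (P D' * gauss (\sum_(j <- i :: s) v j) A)%E.
  apply: (eq_trans _ (eq_trans E1 _)).
    congr (P _); rewrite /D' setIAC; congr (_ `&` _ `&` _).
    by apply/seteqP; split => w /=; rewrite big_cons.
  by congr (_ * _)%E; exact: esym vE.
by rewrite PD' muleAC.
Qed.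

(** A block of variables may be replaced by an event on its sum, and what remains
    is still independent given this event; iterating treats several blocks. *)
Lemma indep_gauss_block (d : measure_display) (T : measurableType d)
    (R : realType) (P : probability T R) (I : eqType) (Y : I -> T -> R)
    (v : I -> R) (s t : seq I) (D : set T) (A : set R) :
  (forall i, measurable_fun setT (Y i)) -> (forall i, 0 <= v i) ->
  measurable D -> uniq (s ++ t) -> indep_gauss P Y v (s ++ t) D ->
  measurable A ->
  let D' := D `&` [set w | A (\sum_(i <- s) Y i w)] in
  [/\ measurable D', P D' = (P D * gauss (\sum_(i <- s) v i)%R A)%E &
      indep_gauss P Y v t D'].
Proof.
move=> mY v0 mD ust iD mA D'.
have mD' : measurable D'.
  apply: measurableI => //; rewrite -[X in measurable X]setTI.
  by apply: (measurable_sum _ mY).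
have aux B : (forall i, measurable (B i)) -> _ :=
  indep_gauss_sum mY v0 mD ust iD mA.
have PD' : P D' = (P D * gauss (\sum_(i <- s) v i)%R A)%E.
  have := aux (fun=> setT) (fun=> measurableT).
  rewrite (_ : \bigcap_(_ in _) _ = setT) ?setIT; last first.
    by apply/seteqP; split.
  move=> ->; rewrite [X in (_ * X)%E]big1 ?mule1// => j _.
  exact: probability_setT.
split => // B mB.
by rewrite aux// PD'.
Qed.

Lemma iid_indep_gauss (d : measure_display) (T : measurableType d)
    (R : realType) (P : probability T R) (I : finType) (v : R)
    (X : I -> {RV P >-> R}) (a : I -> R) (s : seq I) :
  0 < v -> iid_centred_gaussian v X -> uniq s ->
  indep_gauss P (fun i w => a i * X i w) (fun i => a i ^+ 2 * v) s setT.
Proof.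
move=> v0 [indX lawX] us B mB.
pose B' i := (fun x : R => a i * x) @^-1` B i.
have mB' i : measurable (B' i).
  by rewrite -[X in measurable X]setTI; exact: mulrl_measurable.
rewrite probability_setT mul1e setTI.
rewrite (_ : \bigcap_(i in _) _ =
    \bigcap_(i in [set` [set i in s]%SET]) (X i @^-1` B' i)); last first.
  by congr (\bigcap_(i in _) _); apply/seteqP; split => i; rewrite /= inE.
rewrite indX// big_uniq//; apply: eq_big => [i|i _]; first by rewrite inE.
have -> : P (X i @^-1` B' i) = gauss v (B' i).
  by rewrite (gaussE _ v0); exact: lawX.
by apply: gauss_scale => //; exact: ltW.
Qed.

Lemma weighted_sum_law (d : measure_display) (T : measurableType d)
    (R : realType) (P : probability T R) (I : finType) (v : R)
    (X : I -> {RV P >-> R}) (a : I -> R) (A : set R) :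
  0 < v -> iid_centred_gaussian v X -> measurable A ->
  P [set w | A (\sum_i a i * X i w)] = gauss (\sum_i a i ^+ 2 * v) A.
Proof.
move=> v0 iidX mA.
have u : uniq (enum I ++ [::]) by rewrite cats0 enum_uniq.
have mY i : measurable_fun setT (fun w => a i * X i w) by exact: measurable_funM.
have w0 i : 0 <= a i ^+ 2 * v by rewrite mulr_ge0 ?sqr_ge0// ltW.
have ind := iid_indep_gauss a v0 iidX u.
have [_ + _] := indep_gauss_block mY w0 measurableT u ind mA.
rewrite setTI probability_setT mul1e big_enum => <-.
by congr (P _); apply/seteqP; split => w /=; rewrite big_enum.
Qed.

(** The bound depends on the number of summands only through the total variance
    #|I| v, which is 4 for a field of Cilleruelo type whatever its number of
    atoms. *)
Lemma weighted_sum_tail (d : measure_display) (T : measurableType d)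
    (R : realType) (P : probability T R) (I : finType) (v : R)
    (X : I -> {RV P >-> R}) (a : I -> R) (c e y : R) :
  0 < v -> iid_centred_gaussian v X -> #|I|%:R * v <= c ^+ 2 -> 0 <= c ->
  (forall i, `|a i| <= e) -> 0 <= e -> 0 <= y ->
  (P [set w | (c * e * y < `|\sum_i a i * X i w|)%R] <=
   (2 * expR (1 / 2 - y))%:E)%E.
Proof.
move=> v0 iidX vc c0 ae e0 y0.
have mA : measurable [set x : R | c * e * y < `|x|].
  exact: (measurable_ltr_set (measurable_cst _) (@normr_measurable _ setT)).
rewrite (weighted_sum_law a v0 iidX mA).
apply: gauss_tail => //; last exact: mulr_ge0.
apply/andP; split.
  by apply: sumr_ge0 => i _; rewrite mulr_ge0 ?sqr_ge0// ltW.
apply: (@le_trans _ _ (\sum_(i : I) e ^+ 2 * v)).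
  apply: ler_sum => i _; rewrite ler_wpM2r ?(ltW v0)//.
  by rewrite -(real_normK (num_real (a i))) ler_sqr ?nnegrE.
rewrite sumr_const -mulr_natl mulrCA exprMn mulrC.
by rewrite ler_wpM2r ?sqr_ge0.
Qed.

(** The blocks are nested as (S1, (S2, S3)) to match [gauss_cone], where the first
    coordinate is the one compared with the radius of the other two. *)
Lemma three_block_law (d : measure_display) (T : measurableType d)
    (R : realType) (P : probability T R) (I : finType) (v : R)
    (X : I -> {RV P >-> R}) (s1 s2 s3 : seq I)
    (E : set (R * (R * R))) :
  0 < v -> iid_centred_gaussian v X -> uniq (s1 ++ s2 ++ s3) ->
  (size s1)%:R * v = 1 -> (size s2)%:R * v = 1 -> (size s3)%:R * v = 1 ->
  measurable E ->
  P [set w | E (\sum_(i <- s1) X i w,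
               (\sum_(i <- s2) X i w, \sum_(i <- s3) X i w))] =
  joint_law (gauss 1) (joint_law (gauss 1) (gauss 1)) E.
Proof.
move=> v0 iidX u v1 v2 v3 mE.
pose S (s : seq I) w := \sum_(i <- s) X i w.
have ind s : uniq s -> indep_gauss P (fun i w => X i w) (fun=> v) s setT.
  move=> us B mB; have := iid_indep_gauss (fun=> 1) v0 iidX us mB.
  under eq_bigcapr do under eq_fun do rewrite mul1r.
  by rewrite expr1n mul1r.
have mX i : measurable_fun setT (fun w => X i w) by [].
have mS s : measurable_fun setT (S s) by exact: measurable_sum.
have v0' (i : I) : 0 <= v by exact: ltW.
have sumv (s : seq I) : (size s)%:R * v = 1 -> \sum_(i <- s) v = 1.
  by move=> <-; rewrite big_const_seq count_predT iter_addr_0 mulr_natl.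
have mSA s A : measurable A -> measurable (S s @^-1` A).
  by move=> mA; rewrite -[X in measurable X]setTI; exact: mS.
have u23 : uniq (s2 ++ s3) by move: u; rewrite cat_uniq => /and3P[].
have u3 : uniq (s3 ++ [::]).
  by rewrite cats0; move: u23; rewrite cat_uniq => /and3P[].
have law1 A : measurable A -> P (S s1 @^-1` A) = gauss 1 A /\
    indep_gauss P (fun i w => X i w) (fun=> v) (s2 ++ s3) (S s1 @^-1` A).
  move=> mA.
  have [_] := indep_gauss_block mX v0' measurableT u (ind _ u) mA.
  by rewrite setTI probability_setT mul1e sumv.
have law23 A E' : measurable A -> measurable E' ->
    P (S s1 @^-1` A `&` [set w | E' (S s2 w, S s3 w)]) =
    (gauss 1 A * joint_law (gauss 1) (gauss 1) E')%E.
  move=> mA mE'; have [P1 ind1] := law1 A mA.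
  apply: (eq_trans _ (congr1 (fun z => z * _)%E P1)).
  apply: (@joint_law_of_indep d _ _ T (measurableTypeR R) (measurableTypeR R) R
    P (gauss 1) (gauss 1) (S s2) (S s3) (S s1 @^-1` A) E').
  - exact: mS.
  - exact: mS.
  - exact: mSA.
  - move=> A2 A3 mA2 mA3.
    have [mD2 P2 ind2] := indep_gauss_block mX v0' (mSA s1 A mA) u23 ind1 mA2.
    have ind3 : indep_gauss P (fun i w => X i w) (fun=> v) (s3 ++ [::])
        (S s1 @^-1` A `&` [set w | A2 (\sum_(i <- s2) X i w)]).
      by rewrite cats0.
    have [_ P3 _] := indep_gauss_block mX v0' mD2 u3 ind3 mA3.
    rewrite (sumv _ v2) in P2; rewrite (sumv _ v3) in P3.
    rewrite setIA muleA.
    apply: (eq_trans P3).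
    exact: (congr1 (fun z => z * _)%E P2).
  - exact: mE'.
have J : (P (setT `&` [set w | E (S s1 w, (S s2 w, S s3 w))]) =
    P setT * joint_law (gauss 1) (joint_law (gauss 1) (gauss 1)) E)%E.
  apply: (@joint_law_of_indep d _ _ T (measurableTypeR R)
    (measurableTypeR R * measurableTypeR R)%type R P (gauss 1)
    (joint_law (gauss 1) (gauss 1)) (S s1) (fun w => (S s2 w, S s3 w)) setT E).
  - exact: mS.
  - exact: (measurable_fun_pair (mS s2) (mS s3)).
  - exact: measurableT.
  - move=> A B mA mB; rewrite setTI probability_setT mul1e.
    exact: law23.
  - exact: mE.
rewrite setTI in J; apply: (eq_trans J).
by rewrite probability_setT mul1e.
Qed.

(** * Gaussian trigonometric sums with low frequencies *)

Lemma cos_coeffM (R : realType) (t x : R) (n : nat) :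
  cos_coeff (t * x) n = t ^+ n * cos_coeff x n.
Proof. by rewrite /cos_coeff/= exprMn; ring. Qed.

Lemma sin_coeffM (R : realType) (t x : R) (n : nat) :
  sin_coeff (t * x) n = t ^+ n * sin_coeff x n.
Proof. by rewrite /sin_coeff/= exprMn; ring. Qed.

Lemma norm_cos_coeff_le (R : realType) (x : R) (n : nat) :
  `|cos_coeff x n| <= `|x| ^+ n / n`!%:R.
Proof.
rewrite /cos_coeff/= !normrM !normrX normfV !normr_nat normrN1 expr1n mulr1.
apply: ler_wpM2r; first by rewrite invr_ge0.
by apply: ler_piMl; [exact: exprn_ge0|case: (odd n)].
Qed.

Lemma norm_sin_coeff_le (R : realType) (x : R) (n : nat) :
  `|sin_coeff x n| <= `|x| ^+ n / n`!%:R.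
Proof.
rewrite /sin_coeff/= !normrM !normrX normfV !normr_nat normrN1 expr1n mulr1.
apply: ler_wpM2r; first by rewrite invr_ge0.
by apply: ler_piMl; [exact: exprn_ge0|case: (odd n)].
Qed.

(** The powers of t are separated from the frequencies, so that the Taylor
    coefficients are random variables that do not depend on t. *)
Lemma cvg_trig_sum_taylor (R : realType) (I : finType)
    (c al be om : I -> R) (t : R) :
  \sum_(0 <= k < n) t ^+ k * (\sum_i (al i * cos_coeff (om i) k +
     be i * sin_coeff (om i) k) * c i) @[n --> \oo] -->
  \sum_i c i * (al i * cos (t * om i) + be i * sin (t * om i)).
Proof.
under eq_fun.
  move=> n; under eq_bigr do rewrite mulr_sumr.
  rewrite exchange_big/=; under eq_bigr => i _.
    rewrite (_ : \sum_(0 <= k < n) _ = c i * (al i * series (cos_coeff (t * om i)) n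
       + be i * series (sin_coeff (t * om i)) n)); last first.
      rewrite /series/= !mulr_sumr -big_split/= mulr_sumr.
      by apply: eq_bigr => k _; rewrite cos_coeffM sin_coeffM; ring.
    over.
  over.
have cc x : series (cos_coeff x) n @[n --> \oo] --> (cos x : R).
  by rewrite cos.unlock; exact: is_cvg_series_cos_coeff.
have cs x : series (sin_coeff x) n @[n --> \oo] --> (sin x : R).
  by rewrite sin.unlock; exact: is_cvg_series_sin_coeff.
apply: cvg_big => [|i _]; first exact: add_continuous.
apply: cvgMl_tmp.
by apply: cvgD; apply: cvgMl_tmp; [exact: cc|exact: cs].
Qed.

Lemma geometric_sum_le2 (R : realType) (h : R) (n : nat) : 0 <= h <= 1 / 2 ->
  \sum_(0 <= k < n) h ^+ k.+1 <= 2 * h.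
Proof.
move=> /andP[h0 h1].
suff : \sum_(0 <= k < n) h ^+ k.+1 + 2 * h ^+ n.+1 <= 2 * h.
  by have := exprn_ge0 n.+1 h0; lra.
elim: n => [|n IH]; first by rewrite big_geq// add0r expr1.
rewrite big_nat_recr//= (exprS _ n.+1).
by have := exprn_ge0 n.+1 h0; nra.
Qed.

Lemma expR_half_le2 (R : realType) : expR (1 / 2) <= 2 :> R.
Proof.
have h := expR_ge1Dx (- (1 / 2) : R); have p := expR_gt0 (1 / 2 : R).
by move: h; rewrite expRN -[X in _ <= X]mul1r ler_pdivlMr//; lra.
Qed.

Lemma expR_opp_nat_le (R : realType) (k : nat) :
  expR (- k%:R) <= ((2 ^ k)%:R)^-1 :> R.
Proof.
rewrite expRN lef_pV2 ?posrE ?expR_gt0 ?ltr0n ?expn_gt0//.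
rewrite natrX -[k%:R]mulr1 -mulr_natl expRM_natl.
by apply: lerXn2r; rewrite ?nnegrE ?expR_ge0//; have := expR_ge1Dx (1 : R); lra.
Qed.

(** The k-th Taylor coefficient is Gaussian with standard deviation at most
    2 e^k / k!.  Off an event of probability at most 4 exp (- x) 2^(- k) it is at
    most x + k times this, and these probabilities are summable over k >= 1.  Off
    all these events the series is dominated by a geometric one, uniformly in
    0 <= t <= L. *)
Lemma trig_sum_slow (d : measure_display) (T : measurableType d)
    (R : realType) (P : probability T R) (I : finType) (v : R)
    (X : I -> {RV P >-> R}) (al be om : I -> R) (e L x : R) :
  0 < v -> iid_centred_gaussian v X -> #|I|%:R * v <= 4 ->
  (forall i, `|al i| + `|be i| <= 1) -> (forall i, `|om i| <= e) -> 0 <= e ->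
  0 <= L -> L * e <= 1 / 2 -> 0 <= x ->
  exists N : set T, [/\ measurable N, (P N <= (4 * expR (- x))%:E)%E &
    forall w, ~ N w -> forall t, 0 <= t <= L ->
      `|\sum_i X i w * (al i * cos (t * om i) + be i * sin (t * om i)) -
        \sum_i X i w * al i| <= 4 * (L * e) * (x + 1)].
Proof.
move=> v0 iidX vI ab1 ome e0 L0 Le x0.
pose a k i := al i * cos_coeff (om i) k + be i * sin_coeff (om i) k.
pose b k : R := e ^+ k / k`!%:R.
have b0 k : 0 <= b k by rewrite divr_ge0 ?exprn_ge0.
have ak k i : `|a k i| <= b k.
  have ok : `|om i| ^+ k / k`!%:R <= b k.
    apply: ler_wpM2r; first by rewrite invr_ge0.
    by apply: lerXn2r; rewrite ?nnegrE.
  have h1 := le_trans (norm_cos_coeff_le (om i) k) ok.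
  have h2 := le_trans (norm_sin_coeff_le (om i) k) ok.
  apply: (le_trans (ler_normD _ _)).
  apply: (@le_trans _ _ ((`|al i| + `|be i|) * b k)); last exact: ler_piMl.
  rewrite mulrDl; apply: lerD; by rewrite normrM ler_wpM2l.
(* The coefficient of index 0 is the value at t = 0, hence the shift. *)
pose F k := [set w | 2 * b k.+1 * (x + k.+1%:R) < `|\sum_i a k.+1 i * X i w|].
have mF k : measurable (F k).
  apply: measurable_ltr_set => //; apply: measurableT_comp => //.
  by apply: measurable_sum => i; exact: measurable_funM.
have PF k : (P (F k) <= (4 * expR (- x) / (2 ^ k.+1)%:R)%:E)%E.
  have x0k : 0 <= x + k.+1%:R by rewrite addr_ge0.
  apply: le_trans.
    apply: (weighted_sum_tail v0 iidX _ (ler0n R 2) (ak k.+1) (b0 _) x0k).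
    by rewrite -natrX.
  rewrite lee_fin opprD addrA expRD.
  have := expR_opp_nat_le R k.+1; have := expR_half_le2 R.
  rewrite expRD; have := expR_gt0 (- k.+1%:R : R); have := expR_gt0 (- x).
  set h := expR (1 / 2); set y := expR (- x); set z := expR (- k.+1%:R).
  move=> y0 z0 h2 zk; apply: (@le_trans _ _ (4 * y * z)); last first.
    by apply: ler_wpM2l => //; rewrite mulr_ge0// ltW.
  have -> : 2 * (h * y * z) = 2 * h * (y * z) by ring.
  rewrite -[leRHS]mulrA; apply: ler_wpM2r; last lra.
  by rewrite mulr_ge0// ltW.
exists (\bigcup_k F k); split.
- exact: bigcupT_measurable.
- apply: (@le_trans _ _ (\sum_(0 <= k <oo) P (F k))%E).
    apply: measure_sigma_subadditive => //.
    exact: bigcupT_measurable.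
  apply: (@le_trans _ _ (\sum_(0 <= k <oo) (4 * expR (- x) / (2 ^ k.+1)%:R)%:E)%E).
    by apply: lee_nneseries => // k _ _; exact: PF.
  by apply: epsilon_trick0; rewrite mulr_ge0 ?expR_ge0.
move=> w Nw t /andP[t0 tL].
have Wk k : `|\sum_i a k.+1 i * X i w| <= 2 * b k.+1 * (x + k.+1%:R).
  by rewrite leNgt; apply/negP => Fk; apply: Nw; exists k.
have W0 : \sum_i a 0%N i * X i w = \sum_i X i w * al i.
  apply: eq_bigr => i _; rewrite /a /cos_coeff /sin_coeff/= expr0 fact0.
  by rewrite expr0z expr0; field.
have h1 k : `|t ^+ k.+1 * \sum_i a k.+1 i * X i w| <=
    2 * (x + 1) * (L * e) ^+ k.+1.
  rewrite normrM normrX (ger0_norm t0).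
  have tk : t ^+ k.+1 <= L ^+ k.+1 by apply: lerXn2r; rewrite ?nnegrE.
  apply: (@le_trans _ _ (L ^+ k.+1 * (2 * b k.+1 * (x + k.+1%:R)))).
    by apply: ler_pM; rewrite ?exprn_ge0.
  have f0 : 0 < k.+1`!%:R :> R by rewrite ltr0n fact_gt0.
  have xk : (x + k.+1%:R) / k.+1`!%:R <= x + 1.
    rewrite ler_pdivrMr//.
    have k1 : 1 <= k.+1%:R :> R by rewrite ler1n.
    have kf : k.+1%:R <= k.+1`!%:R :> R by rewrite ler_nat; exact: fact_geq.
    by nra.
  have -> : L ^+ k.+1 * (2 * b k.+1 * (x + k.+1%:R)) =
      2 * (L * e) ^+ k.+1 * ((x + k.+1%:R) / k.+1`!%:R).
    by rewrite /b exprMn; ring.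
  rewrite [leRHS]mulrAC; apply: ler_wpM2l => //.
  by rewrite mulr_ge0// exprn_ge0// mulr_ge0.
have Le0 : 0 <= L * e by exact: mulr_ge0.
have := @cvg_trig_sum_taylor R I (fun i => X i w) al be om t.
rewrite -cvg_shiftS => /cvgB /(_ (cvg_cst (\sum_i a 0%N i * X i w))).
move=> /cvg_norm cvgS; rewrite -W0 -(cvg_lim _ cvgS)//.
apply: limr_le; first exact: cvgP cvgS.
apply: nearW => n /=.
rewrite !fctE big_nat_recl//= expr0 mul1r addrAC subrr add0r.
apply: (le_trans (ler_norm_sum _ _ _)).
apply: (@le_trans _ _ (\sum_(0 <= k < n) 2 * (x + 1) * (L * e) ^+ k.+1)).
  by apply: ler_sum => k _; exact: h1.
rewrite -mulr_sumr.
have := @geometric_sum_le2 R (L * e) n; rewrite Le0 Le => /(_ erefl).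
set g := \sum_(_ <= _ < _) _ => g2; nra.
Qed.

(** * Zeroes of a continuous random function on a segment *)

(** By compactness a continuous function without zero is bounded away from 0, and
    it suffices to test this on a dense sequence of times.  Rational times are
    clamped to the segment to stay in it without losing density. *)
Lemma measurable_nonvanishing (d : measure_display) (T : measurableType d)
    (R : realType) (h : R -> T -> R) (L : R) :
  0 <= L -> (forall t, measurable_fun setT (h t)) ->
  (forall w, continuous (h ^~ w)) ->
  measurable [set w | forall t, 0 <= t <= L -> h t w != 0].
Proof.
move=> L0 mh ch.
pose clamp (s : R) := Num.max 0 (Num.min s L).
have clampP s : 0 <= clamp s <= L.
  by rewrite /clamp le_max lexx/= ge_max L0 ge_min lexx orbT.
have clampE t : 0 <= t <= L -> clamp t = t.
  by move=> /andP[t0 tL]; rewrite /clamp min_l// max_r.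
have clampC : continuous clamp.
  move=> s; apply: (continuous_max (f := cst (0 : R))
    (g := fun s : R => Num.min s L)); first exact: cst_continuous.
  apply: (continuous_min (f := id) (g := cst L)); first exact: cvg_id.
  exact: cst_continuous.
pose q k : R := clamp (ratr (odflt 0%Q (unpickle k))).
rewrite (_ : mkset _ = \bigcup_n \bigcap_k
    [set w | n.+1%:R^-1 <= `|h (q k) w|]); last first.
  apply/seteqP; split => w.
    move=> nz.
    have cf : continuous (fun t => `|h t w|).
      by move=> t; apply: cvg_norm; exact: ch.
    have [c c0L cmin] := EVT_min L0 (continuous_subspaceT cf).
    have hc : 0 < `|h c w|.
      by rewrite normr_gt0; apply: nz; move: c0L; rewrite in_itv.
    have [n _ /(_ n (leqnn n)) nc] := near_infty_natSinv_lt (PosNum hc).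
    exists n => // k _ /=; apply: (le_trans (ltW nc)).
    by apply: cmin; rewrite in_itv/=; exact: clampP.
  move=> [n _ hn] t tL; apply/eqP => ht.
  have cf : {for t, continuous (fun s => `|h (clamp s) w|)}.
    apply: cvg_norm; apply: (cvg_comp clamp (h ^~ w)); first exact: clampC.
    exact: ch.
  have n0 : 0 < n.+1%:R^-1 :> R by rewrite invr_gt0.
  have : \forall s \near t, `|h (clamp s) w| < n.+1%:R^-1.
    apply: (cvgr_lt _ cf); by rewrite clampE// ht normr0.
  move=> /nbhs_ballP[_/posnumP[e] eA].
  have /rat_in_itvoo[r /itvP tr] : t < t + e%:num by rewrite ltrDl.
  have /eA /= hr : ball t e%:num (ratr r).
    rewrite /ball/= distrC ltr_distl tr andbT (@le_lt_trans _ _ t) ?tr//.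
    by rewrite lerBlDl lerDr.
  by have := hn (pickle r) I; rewrite /= /q pickleK/= leNgt hr.
apply: bigcupT_measurable => n; apply: bigcapT_measurable => k.
by apply: measurable_ler_set => //; apply: measurableT_comp.
Qed.

Lemma nonvanishing_same_sign (R : realType) (f : R -> R) (L t : R) :
  continuous f -> (forall s, 0 <= s <= L -> f s != 0) -> 0 <= t <= L ->
  0 < f 0 * f t.
Proof.
move=> cf nz /andP[t0 tL].
have f0 : f 0 != 0 by apply: nz; rewrite lexx (le_trans t0).
have ft : f t != 0 by apply: nz; rewrite t0.
rewrite lt_neqAle eq_sym mulf_neq0//= leNgt; apply/negP => neg.
have [c c0t fc] : exists2 c, c \in `[0, t] & f c = 0.
  apply: IVT => //; first exact: continuous_subspaceT.
  rewrite ge_min le_max; have [f00|f00] := ltP (f 0) 0.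
    by rewrite (ltW f00)/= -(nmulr_rle0 (f t) f00) (ltW neg) ?orbT.
  have {}f00 : 0 < f 0 by rewrite lt_neqAle eq_sym f0.
  by rewrite /= andbT -(pmulr_rle0 (f t) f00) (ltW neg) orbT.
move: c0t; rewrite in_itv/= => /andP[c0 ct].
by have := nz c; rewrite fc eqxx c0 (le_trans ct tL) => /(_ isT).
Qed.

Lemma nodal_intersections_eq0 (d : measure_display) (T : measurableType d)
    (R : realType) (G : R * R -> T -> R) (u L : R) (w : T) :
  nodal_intersections G u L w = 0%E <->
  forall t, 0 <= t <= L -> G (t * cos u, t * sin u) w != 0.
Proof.
rewrite /nodal_intersections; split => [cnt t tL|nz].
  apply/eqP => Gt; move: cnt; rewrite /counting.
  case: asboolP => [fA|//] /eqP; rewrite eqe pnatr_eq0.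
  rewrite finmap.cardfs_eq0 => /eqP /(fset_set_set0 fA) A0.
  have : (segment u L `&` [set x | G x w = 0]) (t * cos u, t * sin u).
    by split => //; exists t.
  by rewrite A0.
rewrite (_ : _ `&` _ = set0); first exact: measure0.
rewrite -subset0 => x [[t tL <-] /= Gt].
by have := nz t tL; rewrite Gt eqxx.
Qed.

(** * Times at which the limiting waves cancel *)

Lemma lipschitz_of_derive (R : realType) (f f' : R -> R) :
  (forall x : R, is_derive x (1 : R) f (f' x)) -> (forall x, `|f' x| <= 1) ->
  forall x y, `|f x - f y| <= `|x - y|.
Proof.
move=> df f'1.
have lt x y : x < y -> `|f y - f x| <= `|y - x|.
  move=> xy.
  have [c _ ->] := MVT xy (fun x _ => df x)
    (derivable_within_continuous (fun x _ => @ex_derive _ _ _ _ _ _ _ (df x))).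
  by rewrite normrM ler_piMl.
move=> x y; have [xy|xy|->] := ltgtP x y; last by rewrite !subrr.
  by rewrite distrC (distrC x); exact: lt.
exact: lt.
Qed.

Lemma cos_lipschitz (R : realType) (x y : R) : `|cos x - cos y| <= `|x - y|.
Proof.
apply: (@lipschitz_of_derive R _ (fun x => - sin x)) => z.
by rewrite normrN ler_norml sin_geN1 sin_le1.
Qed.

Lemma sin_lipschitz (R : realType) (x y : R) : `|sin x - sin y| <= `|x - y|.
Proof.
apply: (@lipschitz_of_derive R _ cos) => z.
by rewrite ler_norml cos_geN1 cos_le1.
Qed.

(** A shift by pi / a changes the sign of both waves of frequency a; the four times
    form two pairs that differ by this shift. *)
Lemma trig_cancel4 (R : realType) (a b : R) : a != 0 ->
  let ts := [:: pi / a; pi / b; pi / a + pi / b] in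
  \sum_(t <- 0 :: ts) cos (t * a) = 0 /\ \sum_(t <- 0 :: ts) sin (t * a) = 0.
Proof.
move=> a0 /=; rewrite !big_cons !big_nil !addr0 mul0r cos0 sin0.
rewrite (mulrDl (pi / a)) divfK// (addrC pi) cosDpi sinDpi cospi sinpi.
by split; ring.
Qed.

Definition cancelling_times (R : realType) (u : R) : seq R :=
  if u == pi / 4 then [:: pi / cos u]
  else [:: pi / cos u; pi / sin u; pi / cos u + pi / sin u].

(** For u = pi / 4 the two frequencies agree, so that a single shift by pi / cos u
    <= 2 pi cancels all waves. *)
Lemma cancelling_timesP (R : realType) (u : R) : 0 < u <= pi / 4 ->
  let ts := cancelling_times u in
  [/\ forall t, t \in 0 :: ts -> 0 <= t /\
        forall L, 2 * pi <= L -> long_enough u L -> t <= L,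
      \sum_(t <- 0 :: ts) cos (t * cos u) = 0,
      \sum_(t <- 0 :: ts) sin (t * cos u) = 0,
      \sum_(t <- 0 :: ts) cos (t * sin u) = 0 &
      \sum_(t <- 0 :: ts) sin (t * sin u) = 0].
Proof.
move=> /andP[u0 u4].
have pi0 := pi_gt0 R.
have c0 : 0 < cos u by rewrite cos_gt0_pihalf//; apply/andP; split; lra.
have s0 : 0 < sin u by rewrite sin_gt0_pi// u0/=; lra.
have pc : 0 < pi / cos u by rewrite divr_gt0.
have ps : 0 < pi / sin u by rewrite divr_gt0.
rewrite /= /cancelling_times; case: eqVneq => [uE|une].
  have cs : cos u = sin u.
    have := tan_piquarter R; rewrite -uE /tan => /(congr1 ( *%R^~ (cos u))).
    by rewrite divfK ?gt_eqF// mul1r.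
  split; last 4 first.
  - by rewrite !big_cons big_nil mul0r cos0 divfK ?gt_eqF// cospi; ring.
  - by rewrite !big_cons big_nil mul0r sin0 divfK ?gt_eqF// sinpi; ring.
  - by rewrite -cs !big_cons big_nil mul0r cos0 divfK ?gt_eqF// cospi; ring.
  - by rewrite -cs !big_cons big_nil mul0r sin0 divfK ?gt_eqF// sinpi; ring.
  move=> t; rewrite !inE => /orP[]/eqP->; split => [|L piL _].
  - by [].
  - by lra.
  - exact: ltW.
  apply: le_trans piL.
  rewrite ler_pdivrMr//.
  by have := cos2Dsin2 u; rewrite -cs; nra.
have [cc cs] := @trig_cancel4 R (cos u) (sin u) (lt0r_neq0 c0).
have [sc ss] := @trig_cancel4 R (sin u) (cos u) (lt0r_neq0 s0).
split => //.
- move=> t tts; split => [|L piL [uE|uL]]; first 2 last.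
  - by move: tts; rewrite !inE => /or4P[]/eqP->; lra.
  - by move: tts; rewrite !inE => /or4P[]/eqP->; lra.
  by rewrite uE eqxx in une.
- by move: sc; rewrite !big_cons !big_nil (addrC (pi / sin u)); lra.
- by move: ss; rewrite !big_cons !big_nil (addrC (pi / sin u)); lra.
Qed.

(** * The field along a ray, and oblique segments *)

(** The left summand indexes the cosine coefficients of the field, the right one
    the sine coefficients. *)
Definition wave (R : realType) (I : Type) (j : I + I) : R -> R :=
  match j with inl _ => cos | inr _ => sin end.

Definition wave_index (I : Type) (j : I + I) : I :=
  match j with inl i => i | inr i => i end.

Definition ray_freq (R : realType) (M : nat) (phi : 'I_M -> R) (u : R)
    (j : 'I_(M + M) + 'I_(M + M)) : R :=
  dot2 (cos u, sin u) (atom phi (wave_index j)).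

Definition ray_weight (R : realType) (M : nat) (phi : 'I_M -> R) (u t : R)
    (j : 'I_(M + M) + 'I_(M + M)) : R :=
  Num.sqrt 2 / 2 * wave j (t * ray_freq phi u j).

Lemma field_on_ray (d : measure_display) (T : measurableType d)
    (R : realType) (P : probability T R) (M : nat) (phi : 'I_M -> R)
    (X : ('I_(M + M) + 'I_(M + M))%type -> {RV P >-> R}) (u t : R) (w : T) :
  Num.sqrt 2 / 2 *
    (\sum_j X (inl j) w * cos (dot2 (t * cos u, t * sin u) (atom phi j)) +
     \sum_j X (inr j) w * sin (dot2 (t * cos u, t * sin u) (atom phi j))) =
  \sum_j ray_weight phi u t j * X j w.
Proof.
have dotE j : dot2 (t * cos u, t * sin u) (atom phi j) =
    t * dot2 (cos u, sin u) (atom phi j) by rewrite /dot2/=; ring.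
rewrite big_sumType/= mulrDr !mulr_sumr.
by congr (_ + _); apply: eq_bigr => j _; rewrite dotE /ray_weight/= mulrCA mulrC.
Qed.

(** The frequency for the field with all atoms moved to the coordinate axes. *)
Definition limit_freq (R : realType) (M : nat) (u : R)
    (j : 'I_(M + M) + 'I_(M + M)) : R :=
  match fintype.split (wave_index j) with inl _ => cos u | inr _ => sin u end.

(** The frequencies are cos (u - phi i) and sin (u - phi i). *)
Lemma ray_freq_close (R : realType) (M : nat) (phi : 'I_M -> R) (u e : R) j :
  (forall i, - e < phi i < e) ->
  `|ray_freq phi u j - limit_freq u j| <= e.
Proof.
move=> phie; rewrite /ray_freq /limit_freq /dot2 /atom.
have ue i : `|u - phi i - u| <= e.
  by rewrite addrAC subrr sub0r normrN ler_norml !ltW//; have /andP[] := phie i.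
case: fintype.split => i /=.
  by rewrite -cosB; apply: le_trans (cos_lipschitz _ _) (ue i).
rewrite (_ : cos u * _ + _ = sin (u - phi i)); last by rewrite sinB; ring.
exact: le_trans (sin_lipschitz _ _) (ue i).
Qed.

Lemma wave_lipschitz (R : realType) (I : Type) (j : I + I) (x y : R) :
  `|wave j x - wave j y| <= `|x - y|.
Proof. by case: j => i; [exact: cos_lipschitz|exact: sin_lipschitz]. Qed.

Lemma sqrt2_half_le1 (R : realType) : 0 <= (Num.sqrt 2 / 2 : R) <= 1.
Proof.
rewrite divr_ge0//= ler_pdivrMr// mul1r.
rewrite -[leRHS](ger0_norm (ler0n _ _)) -sqrtr_sqr ler_sqrt;
  last by rewrite exprn_ge0.
by lra.
Qed.

(** The weights would sum to 0 at the limiting frequencies, and at time t the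
    actual ones differ by at most t e. *)
Lemma sum_ray_weight_cancel (R : realType) (M : nat) (phi : 'I_M -> R)
    (u e : R) j :
  0 < u <= pi / 4 -> (forall i, - e < phi i < e) ->
  `|\sum_(t <- 0 :: cancelling_times u) ray_weight phi u t j| <=
  (\sum_(t <- 0 :: cancelling_times u) t) * e.
Proof.
move=> u04 phie; have [ts0 cc sc cs ss] := cancelling_timesP u04.
set ts := 0 :: _.
have lim0 : \sum_(t <- ts) wave j (t * limit_freq u j) = 0.
  rewrite /limit_freq; case: fintype.split => _; case: j => j //=.
rewrite -mulr_sumr normrM.
have /andP[h0 h1] := sqrt2_half_le1 R.
rewrite (ger0_norm h0).
apply: (@le_trans _ _ `|\sum_(t <- ts) wave j (t * ray_freq phi u j)|).
  by rewrite ler_piMl.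
rewrite -[X in `|X|]subr0 -[X in `|_ - X|]lim0 -sumrB.
apply: (le_trans (ler_norm_sum _ _ _)); rewrite mulr_suml.
rewrite !big_seq; apply: ler_sum => t tts.
have [t0 _] := ts0 t tts.
apply: (le_trans (wave_lipschitz _ _ _)).
rewrite -mulrBr normrM (ger0_norm t0) ler_wpM2l//.
exact: ray_freq_close.
Qed.

Lemma measurable_weighted_sum (d : measure_display) (T : measurableType d)
    (R : realType) (P : probability T R) (I : finType)
    (X : I -> {RV P >-> R}) (a : I -> R) :
  measurable_fun setT (fun w => \sum_i a i * X i w).
Proof. by apply: measurable_sum => i; exact: measurable_funM. Qed.

Lemma continuous_ray_sum (R : realType) (M : nat) (phi : 'I_M -> R) (u : R)
    (c : 'I_(M + M) + 'I_(M + M) -> R) :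
  continuous (fun t => \sum_j ray_weight phi u t j * c j).
Proof.
move=> t; apply: cvg_big => [|j _]; first exact: add_continuous.
apply: cvgMr_tmp; apply: cvgMl_tmp.
apply: (cvg_comp (fun s => s * ray_freq phi u j) (wave j)).
  by apply: cvgMr_tmp; exact: cvg_id.
by case: j => j; [exact: continuous_cos|exact: continuous_sin].
Qed.

(** Measurability matters because a probability is only constrained on measurable
    sets. *)
Lemma nodal_zero_setE (d : measure_display) (T : measurableType d)
    (R : realType) (P : probability T R) (M : nat) (phi : 'I_M -> R)
    (X : ('I_(M + M) + 'I_(M + M))%type -> {RV P >-> R}) (u L : R)
    (G : R * R -> T -> R) :
  (forall x w, G x w = Num.sqrt 2 / 2 *
    (\sum_j X (inl j) w * cos (dot2 x (atom phi j)) +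
     \sum_j X (inr j) w * sin (dot2 x (atom phi j)))) -> 0 <= L ->
  [set w | nodal_intersections G u L w = 0%E] =
    [set w | forall t, 0 <= t <= L -> \sum_j ray_weight phi u t j * X j w != 0] /\
  measurable [set w | nodal_intersections G u L w = 0%E].
Proof.
move=> GE L0.
have e : [set w | nodal_intersections G u L w = 0%E] =
    [set w | forall t, 0 <= t <= L -> \sum_j ray_weight phi u t j * X j w != 0].
  apply/seteqP; split => w /=.
    by move/nodal_intersections_eq0 => nz t /nz; rewrite GE field_on_ray.
  move=> nz; apply/nodal_intersections_eq0 => t /nz.
  by rewrite GE field_on_ray.
split => //; rewrite e.
apply: (@measurable_nonvanishing _ _ _
  (fun t w => \sum_j ray_weight phi u t j * X j w)) => // [t|w].
  exact: measurable_weighted_sum.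
exact: continuous_ray_sum.
Qed.

Lemma same_sign_sum_ge (R : realType) (f : R -> R) (ts : seq R) :
  (forall t, t \in ts -> 0 < f 0 * f t) ->
  `|f 0| <= `|\sum_(t <- 0 :: ts) f t|.
Proof.
rewrite big_cons => pos.
have [f0|f0|f0] := ltgtP 0 (f 0).
- have S0 : 0 <= \sum_(t <- ts) f t.
    rewrite big_seq sumr_ge0// => t tts.
    by rewrite -(pmulr_rge0 _ f0) ltW// pos.
  by rewrite !ger0_norm ?lerDl ?addr_ge0// ltW.
- have S0 : \sum_(t <- ts) f t <= 0.
    rewrite big_seq; apply: sumr_le0 => t tts.
    by rewrite -(nmulr_rge0 _ f0) ltW// pos.
  by rewrite (ler0_norm (ltW f0)) ler0_norm; lra.
- by rewrite -f0 normr0.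
Qed.

Lemma field_atoms_variance (R : realType) (M : nat) : (0 < M)%N ->
  [/\ 0 < 4 / (4 * M)%:R :> R,
      #|{: 'I_(M + M) + 'I_(M + M)}|%:R * (4 / (4 * M)%:R) = 4 :> R &
      M%:R * (4 / (4 * M)%:R) = 1 :> R].
Proof.
move=> M0; have m0 : 0 < M%:R :> R by rewrite ltr0n.
rewrite card_sum card_ord (natrM _ 4) (natrD _ (M + M)) (natrD _ M); split.
- by rewrite divr_gt0// mulr_gt0.
- by field; rewrite gt_eqF.
- by field; rewrite gt_eqF.
Qed.

Lemma ray_weight0_variance (R : realType) (M : nat) (phi : 'I_M -> R) (u : R) :
  (0 < M)%N -> \sum_j ray_weight phi u 0 j ^+ 2 * (4 / (4 * M)%:R) = 1.
Proof.
move=> M0; have [v0 _ vM] := field_atoms_variance R M0.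
rewrite big_sumType/= /ray_weight/=.
under eq_bigr do rewrite mul0r cos0 mulr1 expr_div_n sqr_sqrtr//.
under [X in _ + X]eq_bigr do rewrite mul0r sin0 mulr0 expr0n mul0r.
rewrite [X in _ + X]big1// addr0 sumr_const card_ord -[RHS]vM.
have m0 : M%:R != 0 :> R by rewrite pnatr_eq0 -lt0n.
by rewrite -[LHS]mulr_natl (natrD _ M) (natrM _ 4); field.
Qed.

(** The parameter y is the size allowed to the sum over the cancelling times, in
    units of its standard deviation; it will be of order |ln e|. *)
Lemma nodal_prob_oblique (d : measure_display) (T : measurableType d)
    (R : realType) (P : probability T R) (u L e y : R) (G : R * R -> T -> R) :
  0 < u <= pi / 4 -> 2 * pi <= L -> long_enough u L -> 0 < e -> 0 <= y ->
  cilleruelo_type_field P e G ->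
  (P [set w | nodal_intersections G u L w = 0%E] <=
   (2 * ((\sum_(t <- 0 :: cancelling_times u) t) * e) * y + 4 * expR (- y))%:E)%E.
Proof.
move=> u04 piL uL e0 y0 [M [phi [X [M0 _ phie iidX GE]]]].
set ts := 0 :: _; set S := \sum_(t <- ts) t.
have [v0 vJ vM] := field_atoms_variance R M0.
have L0 : 0 <= L by apply: le_trans piL; rewrite mulr_ge0// pi_ge0.
have [ZE mZ] := nodal_zero_setE u GE L0; rewrite ZE in mZ *.
pose g t w := \sum_j ray_weight phi u t j * X j w.
pose a j := \sum_(t <- ts) ray_weight phi u t j.
have [tsP _ _ _ _] := cancelling_timesP u04.
have S0 : 0 <= S by rewrite /S big_seq sumr_ge0// => t /tsP[].
pose D := 2 * (S * e) * y.
have D0 : 0 <= D by rewrite !mulr_ge0// ltW.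
pose A := [set w | `|g 0 w| <= D].
pose B := [set w | D < `|\sum_j a j * X j w|].
have mA : measurable A.
  apply: measurable_ler_set => //; apply: measurableT_comp => //.
  exact: measurable_weighted_sum.
have mB : measurable B.
  apply: measurable_ltr_set => //; apply: measurableT_comp => //.
  exact: measurable_weighted_sum.
apply: (@le_trans _ _ (P (A `|` B))).
  apply: le_measure; rewrite ?inE//; first exact: measurableU.
  move=> w nz.
  have : `|g 0 w| <= `|\sum_j a j * X j w|.
    have -> : \sum_j a j * X j w = \sum_(t <- ts) g t w.
      by rewrite exchange_big/=; apply: eq_bigr => j _; rewrite mulr_suml.
    apply: (@same_sign_sum_ge R (g ^~ w)) => t tts.
    apply: (@nonvanishing_same_sign R (g ^~ w) L).
    - exact: continuous_ray_sum.
    - exact: nz.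
    - have [|t0 tL] := tsP t; first by rewrite inE tts orbT.
      by rewrite t0 tL.
  have [gD _|gD ga] := leP `|g 0 w| D; first by left.
  by right; exact: lt_le_trans ga.
apply: (le_trans (measureU2 _ mA mB)).
rewrite EFinD; apply: leeD.
  have mI : measurable [set x : R | `|x| <= D].
    exact: (measurable_ler_set (@normr_measurable _ setT) (measurable_cst _)).
  have law := weighted_sum_law (ray_weight phi u 0) v0 iidX mI.
  have E := eq_trans law
    (congr1 (fun z => gauss z _) (ray_weight0_variance phi u M0)).
  by rewrite [leLHS]E; exact: gauss_small_ball.
have aS j : `|a j| <= S * e by exact: sum_ray_weight_cancel.
apply: (le_trans (weighted_sum_tail v0 iidX _ (ler0n R 2) aS _ y0)).
- by rewrite vJ; lra.
- by rewrite mulr_ge0// ltW.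
rewrite lee_fin expRD.
have := expR_half_le2 R; have := expR_gt0 (- y); nra.
Qed.

(** * Segments along an axis *)

(** Distinguishes the atoms near (1, 0) from their rotations near (0, 1). *)
Definition near_axis (M : nat) (k : 'I_(M + M)) : bool :=
  if fintype.split k is inl _ then true else false.

Section Demodulation.
Variables (R : realType) (M : nat).
Implicit Type j : ('I_(M + M) + 'I_(M + M))%type.

(** For the wave j, the coefficients of cos (t d_j) and sin (t d_j), with d_j the
    detuning, in the factor of cos t; next come those in the factor of sin t and
    those in the remaining term. *)
Definition cos_ampl j : R * R :=
  match j with
  | inl k => ((near_axis k)%:R, 0)
  | inr k => (0, - (near_axis k)%:R)
  end.
Definition sin_ampl j : R * R :=
  match j with
  | inl k => (0, (near_axis k)%:R)
  | inr k => ((near_axis k)%:R, 0)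
  end.
Definition const_ampl j : R * R :=
  match j with
  | inl k => ((~~ near_axis k)%:R, 0)
  | inr k => (0, - (~~ near_axis k)%:R)
  end.

Lemma ampl_le1 j :
  [/\ `|(cos_ampl j).1| + `|(cos_ampl j).2| <= 1,
      `|(sin_ampl j).1| + `|(sin_ampl j).2| <= 1 &
      `|(const_ampl j).1| + `|(const_ampl j).2| <= 1].
Proof.
by case: j => k /=; case: near_axis;
  rewrite /= ?normrN ?normr1 ?normr0 ?addr0 ?add0r; split.
Qed.

Definition detuning (phi : 'I_M -> R) j : R :=
  limit_freq 0 j - ray_freq phi 0 j.

Definition slow_wave (c : R * R) (s : R) : R := c.1 * cos s + c.2 * sin s.

(** The addition formulas, applied to t f_j = t - t d_j for the atoms near (1, 0).
    For the other atoms the limiting frequency is 0 and t f_j = - t d_j. *)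
Lemma axis_wave_split (phi : 'I_M -> R) (t : R) j :
  wave j (t * ray_freq phi 0 j) =
  cos t * slow_wave (cos_ampl j) (t * detuning phi j) +
  sin t * slow_wave (sin_ampl j) (t * detuning phi j) +
  slow_wave (const_ampl j) (t * detuning phi j).
Proof.
rewrite (_ : ray_freq phi 0 j = limit_freq 0 j - detuning phi j); last first.
  by rewrite /detuning opprB addrC subrK.
rewrite /slow_wave; set s := detuning phi j; clearbody s.
rewrite mulrBr /limit_freq /cos_ampl /sin_ampl /const_ampl /near_axis.
by case: j => k /=; case: fintype.split => _ /=;
  rewrite ?cos0 ?sin0 ?mulr1 ?mulr0 ?cosB ?sinB ?sin0 ?cos0; ring.
Qed.

Definition const_block : seq ('I_(M + M) + 'I_(M + M)) :=
  [seq inl (rshift M i) | i : 'I_M].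
Definition cos_block : seq ('I_(M + M) + 'I_(M + M)) :=
  [seq inl (lshift M i) | i : 'I_M].
Definition sin_block : seq ('I_(M + M) + 'I_(M + M)) :=
  [seq inr (lshift M i) | i : 'I_M].

Lemma blocks_uniq : uniq (const_block ++ cos_block ++ sin_block).
Proof.
have inl_inj : injective (@inl 'I_(M + M) 'I_(M + M)) by move=> ? ? [].
have inr_inj : injective (@inr 'I_(M + M) 'I_(M + M)) by move=> ? ? [].
have uc : uniq const_block.
  rewrite map_inj_uniq ?enum_uniq// => i k e.
  by apply: (@rshift_inj M M); exact: inl_inj e.
have u1 : uniq cos_block.
  rewrite map_inj_uniq ?enum_uniq// => i k e.
  by apply: (@lshift_inj M M); exact: inl_inj e.
have u2 : uniq sin_block.
  rewrite map_inj_uniq ?enum_uniq// => i k e.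
  by apply: (@lshift_inj M M); exact: inr_inj e.
rewrite !cat_uniq uc u1 u2 /= !andbT; apply/andP; split; apply/hasPn => j.
  rewrite mem_cat => /orP[] /mapP[i _ ->]; apply/mapP => -[k _] //.
  by move=> /inl_inj/eqP; rewrite eq_lrshift.
by move=> /mapP[i _ ->]; apply/mapP => -[k _].
Qed.

Lemma near_axisE i :
  near_axis (lshift M i) = true /\ near_axis (rshift M i) = false.
Proof.
rewrite /near_axis (unsplitK (inl i : 'I_M + 'I_M)).
by rewrite (unsplitK (inr i : 'I_M + 'I_M)).
Qed.

Lemma sum_ampl (X : 'I_(M + M) + 'I_(M + M) -> R) :
  [/\ \sum_j X j * (cos_ampl j).1 = \sum_(j <- cos_block) X j,
      \sum_j X j * (sin_ampl j).1 = \sum_(j <- sin_block) X j &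
      \sum_j X j * (const_ampl j).1 = \sum_(j <- const_block) X j].
Proof.
have lE i : near_axis (lshift M i) = true by have [] := near_axisE i.
have rE i : near_axis (rshift M i) = false by have [] := near_axisE i.
rewrite !big_image !big_sumType /= !big_split_ord/=.
by split; rewrite -!big_split/=; apply: eq_big => // i _; rewrite ?lE ?rE/=; ring.
Qed.

End Demodulation.

Lemma norm_cos_sin_comb_le (R : realType) (t p q : R) :
  `|cos t * p + sin t * q| <= Num.sqrt (p ^+ 2 + q ^+ 2).
Proof.
rewrite -sqrtr_sqr ler_sqrt ?addr_ge0 ?sqr_ge0//.
have := cos2Dsin2 t; have := sqr_ge0 (sin t * p - cos t * q).
set c := cos t; set s := sin t => h cs.
have -> : p ^+ 2 + q ^+ 2 = (c ^+ 2 + s ^+ 2) * (p ^+ 2 + q ^+ 2).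
  by rewrite cs mul1r.
by nra.
Qed.

(** The parameter x plays the part of |ln e|. *)
Lemma nodal_prob_axis (d : measure_display) (T : measurableType d)
    (R : realType) (P : probability T R) (L e x : R) (G : R * R -> T -> R) :
  0 <= L -> 0 <= e -> L * e <= 1 / 2 -> 0 <= x ->
  cilleruelo_type_field P e G ->
  ((1 - Num.sqrt 2 / 2 - (24 * (L * e) * (x + 1) + 12 * expR (- x)))%:E <=
   P [set w | nodal_intersections G 0 L w = 0%E])%E.
Proof.
move=> L0 e0 Le x0 [M [phi [X [M0 _ phie iidX GE]]]].
have [v0 vJ vM] := field_atoms_variance R M0.
have [ZE mZ] := nodal_zero_setE 0 GE L0; rewrite ZE in mZ *.
have vJ4 : #|{: 'I_(M + M) + 'I_(M + M)}|%:R * (4 / (4 * M)%:R) <= 4 :> R.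
  by rewrite vJ.
have omee j : `|detuning phi j| <= e.
  by rewrite /detuning distrC; exact: ray_freq_close.
pose W (c : 'I_(M + M) + 'I_(M + M) -> R * R) t w :=
  \sum_j X j w * slow_wave (c j) (t * detuning phi j).
pose D := 4 * (L * e) * (x + 1).
have slow c : (forall j, `|(c j).1| + `|(c j).2| <= 1) -> exists N : set T,
    [/\ measurable N, (P N <= (4 * expR (- x))%:E)%E &
      forall w, ~ N w -> forall t, 0 <= t <= L ->
        `|W c t w - \sum_j X j w * (c j).1| <= D].
  by move=> c1; exact: (trig_sum_slow v0 iidX vJ4 c1 omee e0 L0 Le x0).
have [N1 [mN1 PN1 hN1]] := slow (@cos_ampl R M)
  (fun j => let: And3 h _ _ := ampl_le1 R j in h).
have [N2 [mN2 PN2 hN2]] := slow (@sin_ampl R M)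
  (fun j => let: And3 _ h _ := ampl_le1 R j in h).
have [N3 [mN3 PN3 hN3]] := slow (@const_ampl R M)
  (fun j => let: And3 _ _ h := ampl_le1 R j in h).
pose S (s : seq ('I_(M + M) + 'I_(M + M))) w := \sum_(j <- s) X j w.
pose A := [set w | `|S (const_block M) w| - 3 * D <=
  Num.sqrt (S (cos_block M) w ^+ 2 + S (sin_block M) w ^+ 2)].
have D0 : 0 <= 3 * D by rewrite !mulr_ge0// addr_ge0.
have PA : (P A <= (Num.sqrt 2 / 2 + 2 * (3 * D))%:E)%E.
  apply: le_trans (gauss_cone D0).
  rewrite -(three_block_law v0 iidX (blocks_uniq M) _ _ _ (measurable_cone _)).
  - exact: lexx.
  - by rewrite size_map -cardE card_ord.
  - by rewrite size_map -cardE card_ord.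
  - by rewrite size_map -cardE card_ord.
have mS s : measurable_fun setT (S s) by exact: measurable_sum.
have mA : measurable A.
  have mB := measurable_cone (3 * D).
  have := measurable_fun_pair (mS (const_block M))
    (measurable_fun_pair (mS (cos_block M)) (mS (sin_block M))).
  by move=> /(_ measurableT _ mB); rewrite setTI.
pose U := A `|` (N1 `|` (N2 `|` N3)).
have mU : measurable U by do !apply: measurableU.
have PU : (P U <= (Num.sqrt 2 / 2 + 2 * (3 * D) + 12 * expR (- x))%:E)%E.
  rewrite (_ : _ + _ = Num.sqrt 2 / 2 + 2 * (3 * D) +
    (4 * expR (- x) + (4 * expR (- x) + 4 * expR (- x)))); last by ring.
  rewrite !EFinD -EFinD.
  apply: (le_trans (measureU2 _ _ _)) => //; first by do !apply: measurableU.
  apply: leeD => //.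
  apply: (le_trans (measureU2 _ _ _)) => //; first by do !apply: measurableU.
  apply: leeD => //.
  by apply: (le_trans (measureU2 _ _ _)) => //; apply: leeD.
apply: (@le_trans _ _ (P (~` U))).
  rewrite probability_setC//; move: PU.
  rewrite -(fineK (fin_num_measure P U mU)) -EFinB !lee_fin /D; lra.
apply: le_measure; rewrite ?inE//; first exact: measurableC.
move=> w /= nU t tL.
have [nA [n1 [n2 n3]]] : ~ A w /\ ~ N1 w /\ ~ N2 w /\ ~ N3 w.
  by move: nU; rewrite /U !not_orE.
have := hN1 w n1 t tL; have := hN2 w n2 t tL; have := hN3 w n3 t tL.
have [-> -> ->] := sum_ampl (fun j => X j w).
rewrite -/(S _ w) -/(S _ w) -/(S _ w) => h3 h2 h1.
have gE : \sum_j ray_weight phi 0 t j * X j w = Num.sqrt 2 / 2 *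
    (cos t * W (@cos_ampl R M) t w + sin t * W (@sin_ampl R M) t w +
     W (@const_ampl R M) t w).
  rewrite /W !mulr_sumr -!big_split/= mulr_sumr; apply: eq_bigr => j _.
  by rewrite /ray_weight axis_wave_split; ring.
have s2 : Num.sqrt 2 / 2 != 0 :> R by rewrite gt_eqF// divr_gt0// sqrtr_gt0.
rewrite gE mulf_neq0//; apply/eqP => W0; apply: nA; rewrite /A/=.
apply: le_trans (norm_cos_sin_comb_le t (S (cos_block M) w) (S (sin_block M) w)).
move: W0 h1 h2 h3.
set W1 := W _ t w; set W2 := W _ t w; set W3 := W _ t w.
set S1 := S (cos_block M) w; set S2 := S (sin_block M) w.
set S3 := S (const_block M) w => W0 h1 h2 h3.
have contract (c z : R) : `|c| <= 1 -> `|z| <= D -> `|c * z| <= D.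
  move=> c1 zD; rewrite normrM; apply: le_trans zD.
  by rewrite ler_piMl.
have y1 : `|cos t * (W1 - S1)| <= D.
  by apply: contract => //; rewrite ler_norml cos_geN1 cos_le1.
have y2 : `|sin t * (W2 - S2)| <= D.
  by apply: contract => //; rewrite ler_norml sin_geN1 sin_le1.
have z1 := ler_norm (cos t * S1 + sin t * S2).
have z2 := lerNnormlW (lexx `|cos t * S1 + sin t * S2|).
rewrite lerBlDr ler_norml; move: y1 y2 h3.
rewrite !ler_norml !mulrBr => /andP[? ?] /andP[? ?] /andP[? ?].
by apply/andP; split; lra.
Qed.

(** * The asymptotic statement *)

Unset Implicit Arguments.
Set Strict Implicit.

Theorem proposition1p13 (R : realType) (u : R) (hu : 0 <= u <= pi / 4)
    (alpha : R) (halpha : 0 < alpha) (K : R) :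
  exists C : R, \forall e \near (0 : R)^'+,
    forall (L : R), 2 * pi <= L -> L <= K * e `^ (alpha - 1) ->
    forall (d : measure_display) (T : measurableType d) (P : probability T R)
      (F G : R * R -> T -> R),
      cilleruelo_field P F -> cilleruelo_type_field P e G ->
      (u <> 0 -> long_enough u L ->
        (P [set w | nodal_intersections G u L w = 0%E]
           <= (C * (e `^ alpha * `|ln e|))%:E)%E)
      /\
      (u = 0 ->
        ((1 - Num.sqrt 2 / 2 - C * (e `^ alpha * `|ln e|))%:E
           <= P [set w | nodal_intersections G u L w = 0%E])%E).
Proof.
move: hu => /andP[u0 u4].
pose S : R := `|\sum_(t <- 0 :: cancelling_times u) t|.
pose C : R := 2 * S * `|K| * alpha + 4 + (24 * `|K| * (alpha + 1) + 12).
(* For e <= r the drift L e is at most |K| e^alpha <= 1 / 2. *)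
pose r : R := (1 / (2 * (`|K| + 1))) `^ alpha^-1.
have q0 : 0 < 1 / (2 * (`|K| + 1)) by rewrite divr_gt0// mulr_gt0// ltr_wpDl.
have r0 : 0 < r by exact: powR_gt0.
exists C; near=> e.
have e0 : 0 < e by near: e; exact: nbhs_right_gt.
have e1 : e <= expR (- 1) by near: e; apply: nbhs_right_le; exact: expR_gt0.
have er : e <= r by near: e; exact: nbhs_right_le.
have ln1 : ln e <= -1 by rewrite -(expRK (-1)) ler_ln ?posrE ?expR_gt0.
move=> L piL LK d T P F G _ GE.
have pi2 := pi_ge2 R.
set ea := e `^ alpha; set l := `|ln e|.
have lE : l = - ln e by rewrite /l ler0_norm//; lra.
have l1 : 1 <= l by lra.
have ea0 : 0 < ea by exact: powR_gt0.
have eaE : expR (- (alpha * l)) = ea.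
  by rewrite lE mulrN opprK /ea /powR gt_eqF.
have LeK : L * e <= `|K| * ea.
  have -> : ea = e `^ (alpha - 1) * e.
    rewrite -[X in _ * X]powRr1 ?(ltW e0)// -powRD ?subrK//.
    by rewrite (gt_eqF e0) implybT.
  rewrite mulrA; apply: ler_wpM2r; first exact: ltW.
  apply: (le_trans LK); apply: ler_wpM2r; first exact: powR_ge0.
  exact: ler_norm.
have eK : e <= `|K| * ea.
  by apply: le_trans LeK; nra.
have Kea : `|K| * ea <= 1 / 2.
  have : ea <= 1 / (2 * (`|K| + 1)).
    have rr : r `^ alpha = 1 / (2 * (`|K| + 1)).
      rewrite /r -powRrM mulVf ?gt_eqF// powRr1//; exact: ltW.
    rewrite -rr; apply: ge0_ler_powR; rewrite ?nnegrE ?(ltW halpha)//; exact: ltW.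
  rewrite ler_pdivlMr; last by rewrite mulr_gt0// ltr_wpDl.
  by have := normr_ge0 K; nra.
have al0 : 0 <= alpha * l by rewrite mulr_ge0 ?(ltW halpha)// /l normr_ge0.
have K0 := normr_ge0 K.
split => [un0 uL|uE].
  have u0' : 0 < u by rewrite lt_neqAle eq_sym u0 andbT; apply/eqP.
  have u04 : 0 < u <= pi / 4 by rewrite u0' u4.
  apply: (le_trans (nodal_prob_oblique u04 piL uL e0 al0 GE)).
  rewrite lee_fin eaE.
  have Se : (\sum_(t <- 0 :: cancelling_times u) t) * e <= S * (`|K| * ea).
    apply: (@le_trans _ _ (S * e)).
      by apply: ler_wpM2r; [exact: ltW|exact: ler_norm].
    by apply: ler_wpM2l => //; exact: normr_ge0.
  have h1 : 2 * ((\sum_(t <- 0 :: cancelling_times u) t) * e) * (alpha * l) <=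
      2 * (S * (`|K| * ea)) * (alpha * l).
    by apply: ler_wpM2r => //; apply: ler_wpM2l.
  have h2 : 0 <= 24 * `|K| * (alpha + 1) * (ea * l).
    by rewrite !mulr_ge0 ?addr_ge0// ?ltW//; exact: lt_le_trans l1.
  have h3 : ea <= ea * l by rewrite ler_peMr// ltW.
  by rewrite /C; lra.
rewrite uE.
have L0 : 0 <= L by lra.
have Le : L * e <= 1 / 2 by exact: le_trans LeK Kea.
apply: le_trans (nodal_prob_axis L0 (ltW e0) Le al0 GE).
rewrite lee_fin eaE.
have h1 : 24 * (L * e) * (alpha * l + 1) <= 24 * (`|K| * ea) * ((alpha + 1) * l).
  apply: ler_pM.
  - by rewrite !mulr_ge0// ltW.
  - by rewrite addr_ge0.
  - by apply: ler_wpM2l.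
  - by lra.
have h2 : 0 <= 2 * S * `|K| * alpha * (ea * l).
  rewrite !mulr_ge0 ?normr_ge0// ?ltW//; exact: lt_le_trans l1.
have h3 : ea <= ea * l by rewrite ler_peMr// ltW.
by rewrite /C; lra.
Unshelve. all: by end_near. Qed.
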